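(* Let $1\le r\le 5$ be an integer and $0<\delta\le1$. Let $c(z)=(z-1+\delta)^r$, $b(z)=(z-1+\delta)^r-(z-1)^r$, and $$\mathcal{D}_{-\infty}=\{\mu\in\mathbb{C}:\ \text{every root } \zeta\in\mathbb{C}\text{ of } c(\zeta)-\mu b(\zeta)\text{ satisfies }|\zeta|<1\}.$$ Then $\mathcal{D}_{-\infty}$ is simply connected, contains the origin $\mu=0$, and its boundary is $$\partial\mathcal{D}_{-\infty}=\Big\{\frac{(z-1+\delta)^r}{(z-1+\delta)^r-(z-1)^r}:\ |z|=1,\ \arg z_0\le\arg z\le 2\pi-\arg z_0\Big\},$$ where $z_0=1$ if $r=1$, and $$z_0=\frac{2-\delta-2(1-\delta)\cos(\pi/r)e^{i\pi/r}}{2-\delta-2\cos(\pi/r)e^{i\pi/r}}\quad\text{if }2\le r\le5.$$ Moreover, let $m_r$ (respectively $m_l$) be the right-most (respectively left-most) point of $\partial\mathcal{D}_{-\infty}$. Then $m_r$ (respectively $m_l$) is obtained at the parameter value $z=z_0$ (respectively $z=-1$). Thus $$\text{for } r=1:\quad m_l=\frac{-(2-\delta)}{\delta},\qquad m_r=1,$$ $$\text{for } 2\le r\le5:\quad m_l=\frac{-(2-\delta)^r}{2^r-(2-\delta)^r},\qquad m_r=\frac{(2-\delta)^r}{(2-\delta)^r+2^r\cos^r(\pi/r)}.$$ Both $m_l$ and $m_r$ lie on the real axis.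
   Context: Right-most and left-most points of a subset of $\mathbb{C}$ are the points of largest and smallest real part. In the description of the boundary curve, arguments are measured in $[0,2\pi]$: the point $z$ runs counterclockwise along the unit circle from angle $\arg z_0$ to angle $2\pi-\arg z_0$ (with $\arg 1=0$ for the starting value, so that when $z_0=1$ the whole unit circle is traversed). *)

(* Defs.v *)
From HB Require Import structures.
From mathcomp Require Import all_boot all_order all_algebra.
From mathcomp Require Import all_classical all_reals all_analysis.
From mathcomp Require Import complex.

Set Implicit Arguments.
Unset Strict Implicit.
Unset Printing Implicit Defensive.

Import Order.TTheory GRing.Theory Num.Theory numFieldNormedType.Exports.

Local Open Scope classical_set_scope.
Local Open Scope ring_scope.
Local Open Scope complex_scope.

(* The usual topology of the complex plane: the one that the library gives to
   any numFieldType, here made available on the type [R[i]] itself. *)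
#[warnings="-redundant-canonical-projection"]
HB.instance Definition _ (R : rcfType) := NormedModule.copy R[i] R[i]^o.

Definition boundary (T : topologicalType) (A : set T) : set T :=
  closure A `\` A°.

Definition unit_itv (R : realType) : set R := `[0, 1]%classic.
Arguments unit_itv : clear implicits.

Definition path_connected (R : realType) (A : set R[i]) : Prop :=
  forall x y, A x -> A y ->
  exists p : R -> R[i],
    [/\ {within unit_itv R, continuous p}, p @` unit_itv R `<=` A,
        p 0 = x & p 1 = y].

(* [H (s, t)] is the point at time [t] of the [s]-th loop. *)
Definition null_homotopic_in (R : realType) (A : set R[i]) (p : R -> R[i]) :=
  exists H : R * R -> R[i],
    [/\ {within unit_itv R `*` unit_itv R, continuous H},
        H @` (unit_itv R `*` unit_itv R) `<=` A,
        {in unit_itv R, forall t, H (0, t) = p t},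
        {in unit_itv R, forall t, H (1, t) = p 0} &
        {in unit_itv R, forall s, H (s, 0) = p 0 /\ H (s, 1) = p 0}].

Definition simply_connected (R : realType) (A : set R[i]) : Prop :=
  path_connected A /\
  forall p : R -> R[i],
    {within unit_itv R, continuous p} -> p @` unit_itv R `<=` A -> p 0 = p 1 ->
    null_homotopic_in A p.

Definition rightmost (R : realType) (A : set R[i]) (m : R[i]) : Prop :=
  A m /\ forall w, A w -> complex.Re w <= complex.Re m.

Definition leftmost (R : realType) (A : set R[i]) (m : R[i]) : Prop :=
  A m /\ forall w, A w -> complex.Re m <= complex.Re w.

(* e^(i t) *)
Definition expi (R : realType) (t : R) : R[i] := cos t +i* sin t.

(* The argument in [0, 2 pi), see [cargP]; the value at 0 is irrelevant. *)
Definition carg (R : realType) (z : R[i]) : R :=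
  let a := acos (complex.Re z / complex.Re `|z|) in
  if 0 <= complex.Im z then a else 2 * pi - a.

Lemma cargP (R : realType) (z : R[i]) : z != 0 ->
  0 <= carg z < 2 * pi /\ z = `|z| * expi (carg z).
Proof.
case: z => x y z0.
rewrite /carg normc_def /=; set n := Num.sqrt _.
have n2 : n ^+ 2 = x ^+ 2 + y ^+ 2 by rewrite sqr_sqrtr ?addr_ge0 ?sqr_ge0.
have n0 : 0 < n.
  rewrite sqrtr_gt0 lt_neqAle addr_ge0 ?sqr_ge0// andbT eq_sym.
  apply: contra z0; rewrite paddr_eq0 ?sqr_ge0// !sqrf_eq0.
  by case/andP=> /eqP-> /eqP->.
have nn0 : n != 0 by rewrite gt_eqF.
have yn : (y / n) ^+ 2 = 1 - (x / n) ^+ 2.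
  apply/esym/eqP; rewrite subr_eq !expr_div_n -mulrDl [y ^+ 2 + _]addrC -n2.
  by rewrite divff// expf_neq0.
have xn1 : -1 <= x / n <= 1.
  rewrite -ler_norml -(@ler_pXn2r _ 2) ?nnegrE// expr1n real_normK ?num_real//.
  by rewrite -subr_ge0 -yn sqr_ge0.
have sE : sin (acos (x / n)) = `|y / n|.
  by rewrite sin_acos// -yn sqrtr_sqr.
have nE : `|y / n| = `|y| / n by rewrite normrM normfV (gtr0_norm n0).
have nK u : n * (u / n) = u by rewrite mulrC divfK.
have ge0a := acos_ge0 xn1; have lepia := acos_lepi xn1.
have pi0 := pi_gt0 R.
case: ifPn => [y0|]; last rewrite -ltNge => y0.
- split.
    rewrite ge0a (le_lt_trans lepia)//.
    by rewrite mulr_natl mulr2n ltrDl.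
  by apply/eqP; rewrite /expi acosK// sE nE (ger0_norm y0) eq_complex /=
       !mul0r subr0 addr0 !nK !eqxx.
- have a0 : 0 < acos (x / n).
    rewrite lt_neqAle ge0a andbT; apply/eqP => a0.
    move: sE; rewrite -a0 sin0 => /esym/eqP; rewrite normr_eq0 mulf_eq0 invr_eq0.
    by rewrite (negbTE nn0) orbF (lt_eqF y0).
  split.
    rewrite subr_ge0 (le_trans lepia) ?mulr_natl ?mulr2n ?lerDl ?(ltW pi0)//=.
    by rewrite ltrBlDr ltrDl.
  have c2 : cos (2 * pi - acos (x / n)) = x / n.
    by rewrite mulr_natl addrC cosD2pi cosN acosK.
  have s2 : sin (2 * pi - acos (x / n)) = y / n.
    by rewrite mulr_natl addrC sinD2pi sinN sE nE (ltr0_norm y0) mulNr opprK.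
  by apply/eqP; rewrite /expi c2 s2 eq_complex /= !mul0r subr0 addr0 !nK !eqxx.
Qed.

Definition cpol (R : realType) (r : nat) (delta : R) (z : R[i]) : R[i] :=
  (z - 1 + delta%:C) ^+ r.

Definition bpol (R : realType) (r : nat) (delta : R) (z : R[i]) : R[i] :=
  (z - 1 + delta%:C) ^+ r - (z - 1) ^+ r.

Definition Dminfty (R : realType) (r : nat) (delta : R) : set R[i] :=
  [set mu | forall zeta : R[i],
     cpol r delta zeta - mu * bpol r delta zeta = 0 -> `|zeta| < 1].

Definition zstart (R : realType) (r : nat) (delta : R) : R[i] :=
  if r == 1%N then 1 else
  let w := (cos (pi / r%:R))%:C * expi (pi / r%:R) in
  (2 - delta%:C - 2 * (1 - delta%:C) * w) / (2 - delta%:C - 2 * w).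

(* The parameter range of the boundary curve: the arc of the unit circle run
   counterclockwise from angle [arg z0] to angle [2 pi - arg z0]. *)
Definition param_arc (R : realType) (r : nat) (delta : R) : set R[i] :=
  [set expi t | t in `[carg (zstart r delta), 2 * pi - carg (zstart r delta)]%classic].

Definition curve (R : realType) (r : nat) (delta : R) (z : R[i]) : R[i] :=
  cpol r delta z / bpol r delta z.

(* Main.v *)
Require Import Defs.
From mathcomp Require Import all_boot all_order all_algebra.
From mathcomp Require Import all_classical all_reals all_analysis.
From mathcomp Require Import complex ring lra.
Import Order.TTheory GRing.Theory Num.Theory numFieldNormedType.Exports.
Import Normc.
Local Open Scope classical_set_scope.
Local Open Scope ring_scope.
Local Open Scope complex_scope.

Set Implicit Arguments.
Unset Strict Implicit.
Unset Printing Implicit Defensive.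

Local Notation re := (@complex.Re _).
Local Notation im := (@complex.Im _).

(** Write [k = 2 / (2 - delta)], [K = k ^+ r > 1], and replace the root [zeta] by
    [v = (zeta - 1) / (k * (zeta - 1 + delta))]. This Moebius map sends the
      closed
    exterior of the unit disc to the disc [|v|^2 <= re v], which has diameter
    [0, 1], and [c(zeta) - mu b(zeta) = 0] becomes [mu * (1 - K * v ^+ r) = 1].
    So [mu] belongs to the region exactly when no [r]-th root of
    [Y = (1 - mu^-1) / K] lies in that disc ([DminftyE], [region_gap]).

    All [r]-th roots of [Y] have the same modulus, hence only a right-most one
    matters, and right-most are the principal ones, those in the sector
    [|arg v| <= pi / r] ([principal_max]). Their real part is a continuous
    function of [Y], because the roots of nearby numbers are close to each other
    ([root_near]). So the region is open, and its boundary consists of the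
    [mu = (1 - K * v ^+ r)^-1] with [v] principal and on the circle
    [|v|^2 = re v] ([boundary_region]). Such [v] form an arc, whose preimage in
    the unit circle is the parameter arc of the statement, with [zeta = -1] for
    [v = 1] and [zeta = z0] for the end point [v = cos (pi / r) e^(i pi / r)]
    ([curve_param_arc]).

    For simple connectedness, [mu / (mu - 1) = v ^- r / K] is a homeomorphism of
    the region onto a set that is star-shaped with respect to 0: dividing [v ^-
      r]
    by [t >= 1] multiplies the roots [v] by [t ^ (1 / r)], which cannot bring
      them
    into a disc that is itself star-shaped at its boundary point 0
    ([region_simply_connected]). An explicit based homotopy contracts the loops
    of a star-shaped set ([star_simply_connected]).

    For the extremal points, a real part of [(1 - K * Y)^-1] is compared with
      its
    value at a real [Y], which amounts to saying on which side of a circle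
    centred on the real axis the number [Y^-1 = v ^- r] lies. With [c = re v]
      one
    has [|Y|^2 = c ^+ r], and [re Y] is a polynomial in [c]; the bounds then
    reduce to two polynomial inequalities in [c] for each [r <= 5]
    ([root_arc_ineq]), which do not involve [K]. *)

(** * The complex plane *)

Lemma complex_ext (R : realType) (z w : R[i]) :
  re z = re w -> im z = im w -> z = w.
Proof. by case: z w => [a b] [c d] /= -> ->. Qed.

Lemma normcR (R : realType) (z : R[i]) : `|z| = (normc z)%:C.
Proof. by []. Qed.

Lemma normc_ge0 (R : realType) (z : R[i]) : 0 <= normc z.
Proof. by case: z => a b /=; exact: sqrtr_ge0. Qed.

Lemma normc_sqr (R : realType) (z : R[i]) :
  normc z ^+ 2 = re z ^+ 2 + im z ^+ 2.
Proof. by case: z => a b /=; rewrite sqr_sqrtr ?addr_ge0 ?sqr_ge0. Qed.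

Lemma normcX (R : realType) (z : R[i]) n : normc (z ^+ n) = normc z ^+ n.
Proof. by elim: n => [|n IH]; rewrite ?expr0 ?normc1// !exprS normcM IH. Qed.

Lemma normc_eq0 (R : realType) (z : R[i]) : (normc z == 0) = (z == 0).
Proof. by apply/eqP/eqP => [/eq0_normc|->]//; rewrite normc0. Qed.

Lemma normc_gt0 (R : realType) (z : R[i]) : (0 < normc z) = (z != 0).
Proof. by rewrite -normc_eq0 lt_neqAle normc_ge0 andbT eq_sym. Qed.

Lemma normcC (R : realType) (x : R) : normc x%:C = `|x|.
Proof. by rewrite /= expr0n addr0 sqrtr_sqr. Qed.

Lemma normcB (R : realType) (z w : R[i]) : normc (z - w) = normc (w - z).
Proof. by rewrite -opprB normcN. Qed.

Lemma ler_normcB (R : realType) (z w : R[i]) :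
  `|normc z - normc w| <= normc (z - w).
Proof.
have h (a b : R[i]) : normc a - normc b <= normc (a - b).
  by rewrite lerBlDr (le_trans _ (le_normcD _ _))// subrK.
by rewrite ler_norml h andbT lerNl opprB normcB h.
Qed.

Lemma ler_Re_normc (R : realType) (z : R[i]) : `|re z| <= normc z.
Proof.
rewrite -(ler_pXn2r (n := 2)) ?nnegrE ?normc_ge0// normc_sqr.
by rewrite real_normK ?num_real// lerDl sqr_ge0.
Qed.

Lemma cReB (R : realType) (z w : R[i]) : re (z - w) = re z - re w.
Proof. by case: z w => [a b] [c d]. Qed.

Lemma cImB (R : realType) (z w : R[i]) : im (z - w) = im z - im w.
Proof. by case: z w => [a b] [c d]. Qed.

Lemma cReM (R : realType) (z w : R[i]) : re (z * w) = re z * re w - im z * im w.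
Proof. by case: z w => [a b] [c d]. Qed.

Lemma cImM (R : realType) (z w : R[i]) : im (z * w) = re z * im w + im z * re w.
Proof. by case: z w => [a b] [c d]. Qed.

Lemma cReZ (R : realType) (x : R) (w : R[i]) : re (x%:C * w) = x * re w.
Proof. by rewrite cReM /= mul0r subr0. Qed.

Lemma cReV (R : realType) (z : R[i]) : re z^-1 = re z / normc z ^+ 2.
Proof. by rewrite normc_sqr; case: z => a b. Qed.

Lemma nbhs_normcP (R : realType) (z : R[i]) (P : set R[i]) :
  nbhs z P <-> exists2 e : R, 0 < e & forall w, normc (w - z) < e -> P w.
Proof.
split.
  case=> -[e e'] /=; rewrite ltcE /= => /andP[/eqP-> e0] eP.
  exists e => // w we; apply: eP.
  by rewrite /ball_/= -[`|_|]/((normc _)%:C) normcB ltcR.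
case=> e e0 eP; exists e%:C; first by rewrite /= ltcR.
move=> w; rewrite /ball_/= -[`|_|]/((normc _)%:C) normcB ltcR; exact: eP.
Qed.

Lemma continuous_normc (R : realType) : continuous (@normc R).
Proof.
move=> z A [e /= e0 eA]; apply/nbhs_normcP; exists e => // w we; apply: eA.
by rewrite /ball_/= (le_lt_trans (ler_normcB _ _))// normcB.
Qed.

Lemma continuous_realC (R : realType) : continuous (fun x : R => x%:C).
Proof.
move=> x A /nbhs_normcP[e e0 eA].
exists e => //= y; rewrite /ball_/= => xy; apply: eA.
by rewrite -rmorphB normcC distrC.
Qed.

Lemma nbhs_continuous_gt (R : realType) (F : R[i] -> R) (z : R[i]) (a : R) :
  {for z, continuous F} -> a < F z -> nbhs z [set w | a < F w].
Proof.
move=> cF aF; apply: (cF [set x | a < x]).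
by exists (F z - a); rewrite /= ?subr_gt0// => x /=;
  rewrite /ball_/= ltr_norml; lra.
Qed.

Lemma nbhs_continuous_lt (R : realType) (F : R[i] -> R) (z : R[i]) (a : R) :
  {for z, continuous F} -> F z < a -> nbhs z [set w | F w < a].
Proof.
move=> cF aF; apply: (cF [set x | x < a]).
by exists (a - F z); rewrite /= ?subr_gt0// => x /=;
  rewrite /ball_/= ltr_norml; lra.
Qed.

Lemma nbhsCI (R : realType) (z : R[i]) (A B : set R[i]) :
  nbhs z A -> nbhs z B -> nbhs z (A `&` B).
Proof. by move=> zA zB; exact: (@filterI _ _ (nbhs_filter z)). Qed.

Lemma nbhs_neq0 (R : realType) (z : R[i]) : z != 0 -> nbhs z [set w | w != 0].
Proof.
move=> z0; apply: filterS (nbhs_continuous_gt (continuous_normc (x := z)) (_ :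
  0 < normc z)).
  by move=> w /=; apply: contraTneq => ->; rewrite normc0 ltxx.
by rewrite normc_gt0.
Qed.

Lemma realC_eq0 (R : realType) (x : R) : (x%:C == 0) = (x == 0).
Proof. by rewrite eq_complex /= eqxx andbT. Qed.

(** Pointwise forms of the continuity of the operations on the complex plane:
    with the type fixed they unify with functions written as abstractions. *)
Lemma continuousCD (R : realType) (T : topologicalType) (f g : T -> R[i]) x :
  {for x, continuous f} -> {for x, continuous g} ->
  {for x, continuous (fun y => f y + g y)}.
Proof. exact: (@continuousD R[i] R[i]). Qed.

Lemma continuousCB (R : realType) (T : topologicalType) (f g : T -> R[i]) x :
  {for x, continuous f} -> {for x, continuous g} ->
  {for x, continuous (fun y => f y - g y)}.
Proof. exact: (@continuousB R[i] R[i]). Qed.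

Lemma continuousCM (R : realType) (T : topologicalType) (f g : T -> R[i]) x :
  {for x, continuous f} -> {for x, continuous g} ->
  {for x, continuous (fun y => f y * g y)}.
Proof. exact: (@continuousM R[i] T). Qed.

Lemma continuousCV (R : realType) (T : topologicalType) (f : T -> R[i]) x :
  f x != 0 -> {for x, continuous f} -> {for x, continuous (fun y => (f y)^-1)}.
Proof. exact: (@continuousV R[i] T). Qed.

Lemma continuousCX (R : realType) (T : topologicalType) (f : T -> R[i]) n x :
  {for x, continuous f} -> {for x, continuous (fun y => f y ^+ n)}.
Proof.
move=> cf; elim: n => [|[|n] IH]; [|exact: cf|exact: (continuousCM cf IH)].
exact: (@cst_continuous T R[i] 1 x).
Qed.

Section ContinuousReal.
Variables (R : realType) (T : topologicalType) (f g : T -> R) (x : T).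
Hypotheses (cf : {for x, continuous f}) (cg : {for x, continuous g}).

Lemma continuousRD : {for x, continuous (fun y => f y + g y)}.
Proof. exact: (@continuousD R R). Qed.

Lemma continuousRB : {for x, continuous (fun y => f y - g y)}.
Proof. exact: (@continuousB R R). Qed.

Lemma continuousRM : {for x, continuous (fun y => f y * g y)}.
Proof. exact: (@continuousM R T). Qed.

Lemma continuousRmin : {for x, continuous (fun y => Num.min (f y) (g y))}.
Proof. exact: (@continuous_min R T). Qed.

Lemma continuousRmax : {for x, continuous (fun y => Num.max (f y) (g y))}.
Proof. exact: (@continuous_max R T). Qed.
End ContinuousReal.

Lemma expiX (R : realType) (t : R) n : expi t ^+ n = expi (n%:R * t).
Proof.
elim: n => [|n IH]; first by rewrite expr0 mul0r /expi cos0 sin0.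
rewrite exprS IH -addn1 natrD mulrDl mul1r addrC /expi cosD sinD.
by apply: complex_ext; rewrite ?cReM ?cImM //= addrC.
Qed.

Lemma normc_expi (R : realType) (t : R) : normc (expi t) = 1.
Proof. by rewrite /= cos2Dsin2 sqrtr1. Qed.

(** The arguments range over an interval centred at 0, so that dividing them by
    [r] gives the roots in the sector of half-angle [pi / r]. *)
Lemma polarP (R : realType) (z : R[i]) :
  exists2 t, - pi <= t <= pi & z = (normc z)%:C * expi t.
Proof.
have pi0 := pi_gt0 R.
have [->|z0] := eqVneq z 0.
  by exists 0; [rewrite lerNl oppr0 ltW// |rewrite normc0 mul0r].
have [/andP[t0 t1] zE] := cargP z0.
have [tpi|tpi] := leP (carg z) pi.
  by exists (carg z) => //; rewrite tpi andbT; lra.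
exists (carg z - pi *+ 2).
  by rewrite mulr2n; lra.
rewrite {1}zE; congr (_ * _).
by rewrite /expi -(cosD2pi (_ - _)) -(sinD2pi (_ - _)) subrK.
Qed.

(** * Principal roots *)

(** [v] is, among the [r]-th roots of [v ^+ r], one of those whose argument is
    closest to 0: it lies in the sector of half-angle [pi / r]. *)
Definition principal (R : realType) (r : nat) (v : R[i]) : Prop :=
  normc v * cos (pi / r%:R) <= re v.

Lemma normc_root (R : realType) (r : nat) (u v : R[i]) : (0 < r)%N ->
  u ^+ r = v ^+ r -> normc u = normc v.
Proof.
move=> r0 uv; apply/eqP; rewrite -(eqrXn2 r0) ?normc_ge0//.
by rewrite -!normcX uv.
Qed.

Lemma ex_real_root (R : realType) (r : nat) (x : R) : (0 < r)%N -> 0 <= x ->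
  exists2 y, 0 <= y & y ^+ r = x.
Proof.
move=> r0 x0; exists (x `^ r%:R^-1); first exact: powR_ge0.
by rewrite -powR_mulrn ?powR_ge0// -powRrM mulVf ?powRr1// pnatr_eq0 -lt0n.
Qed.

Lemma ler_cos (R : realType) :
  {in `[0, pi] &, {mono (@cos R) : x y /~ y <= x}}.
Proof. by move=> x y xI yI; rewrite !leNgt ltr_cos. Qed.

Lemma piV_bounds (R : realType) (r : nat) : (0 < r)%N ->
  0 <= (pi / r%:R : R) <= pi.
Proof.
move=> r0; have pi0 := pi_ge0 R.
by rewrite divr_ge0//= ler_pdivrMr ?ltr0n// ler_peMr// ler1n.
Qed.

Lemma principal_expi (R : realType) (r : nat) (p t : R) : (0 < r)%N ->
  0 <= p -> - (pi / r%:R) <= t <= pi / r%:R -> principal r (p%:C * expi t).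
Proof.
move=> r0 p0 tr; rewrite /principal normcM normcC normc_expi mulr1 cReZ
  ger0_norm//.
have pi0 := pi_ge0 R.
rewrite ler_wpM2l//= -(cos_norm t).
have h : `|t| <= pi / r%:R by rewrite ler_norml.
have /andP[h0 h2] := @piV_bounds R r r0.
have t0 : 0 <= `|t| by [].
rewrite ler_cos // in_itv/= ?h0 ?h2 ?t0//=; exact: le_trans h h2.
Qed.

Lemma ex_principal_root (R : realType) (r : nat) (Y : R[i]) : (0 < r)%N ->
  exists2 v, v ^+ r = Y & principal r v.
Proof.
move=> r0; have [t tpi YE] := polarP Y.
have [p p0 pE] := ex_real_root r0 (normc_ge0 Y).
exists (p%:C * expi (t / r%:R)).
  rewrite exprMn expiX -rmorphXn pE [r%:R * _]mulrCA divff ?mulr1//.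
  by rewrite pnatr_eq0 -lt0n.
apply: principal_expi => //.
by rewrite -mulNr !ler_pM2r ?invr_gt0 ?ltr0n.
Qed.

Lemma principal_polar (R : realType) (r : nat) (v : R[i]) : (0 < r)%N ->
  principal r v ->
  exists2 t, - (pi / r%:R) <= t <= pi / r%:R & v = (normc v)%:C * expi t.
Proof.
move=> r0 pv; have pi0 := pi_ge0 R.
have /andP[h0 h2] := @piV_bounds R r r0.
have [v0|v0] := eqVneq v 0.
  by exists 0; [rewrite lerNl oppr0 h0|rewrite v0 normc0 mul0r].
have [t tpi vE] := polarP v; exists t => //.
have n0 : 0 < normc v by rewrite normc_gt0.
move: pv; rewrite /principal {2}vE cReZ /= ler_pM2l// -(cos_norm t).
rewrite -ler_norml; move: tpi; rewrite -ler_norml => tpi.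
by rewrite ler_cos // in_itv/= ?h0 ?h2 ?tpi ?normr_ge0.
Qed.

(** Two roots of the same number in the sector of half-angle [pi / r], one of
    them in its interior, have arguments less than [2 pi / r] apart and hence
    coincide; so no root lies further to the right than a principal one. *)
Lemma principal_max (R : realType) (r : nat) (u v : R[i]) : (0 < r)%N ->
  principal r v -> u ^+ r = v ^+ r -> re u <= re v.
Proof.
move=> r0 pv uv; rewrite leNgt; apply/negP => ltvu.
have nuv := normc_root r0 uv.
have rp : 0 < r%:R :> R by rewrite ltr0n.
have pi0 := pi_gt0 R.
have pu : principal r u by rewrite /principal nuv (le_trans pv)// ltW.
have [t tr vE] := principal_polar r0 pv.
have [s sr uE] := principal_polar r0 pu.
have n0 : 0 < normc v.
  rewrite lt_neqAle normc_ge0 andbT; apply/eqP => n0.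
  by move: ltvu; rewrite uE vE nuv -n0 !cReZ !mul0r ltxx.
move: ltvu; rewrite uE vE nuv !cReZ/= ltr_pM2l// => cts.
have /andP[h0 h2] := @piV_bounds R r r0.
have lst : `|s| < `|t|.
  rewrite -ltr_cos ?in_itv/= ?normr_ge0 /= ?cos_norm//;
    rewrite (le_trans _ h2)//;
    by rewrite ler_norml.
(* the common power forces the angles [r t] and [r s] to differ by a multiple
   of [2 pi] *)
have : expi (r%:R * s) = expi (r%:R * t).
  move: uv; rewrite uE vE nuv !exprMn !expiX; apply: mulfI.
  by rewrite expf_neq0// eq_complex /= negb_and gt_eqF.
case=> cE sE.
have c1 : cos (r%:R * (t - s)) = 1.
  by rewrite mulrBr cosB cE sE -!expr2 cos2Dsin2.
have dlt : `|r%:R * (t - s)| < pi *+ 2.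
  rewrite normrM gtr0_norm// -ltr_pdivlMl// mulr2n mulrDr mulrC.
  rewrite (le_lt_trans (ler_normB _ _))// ler_ltD//; first by rewrite ler_norml.
  by rewrite (lt_le_trans lst)// ler_norml.
have dge : 0 < `|r%:R * (t - s)|.
  rewrite normr_gt0 mulf_neq0//; first by rewrite gt_eqF.
  by rewrite subr_eq0; apply/eqP => ts; rewrite ts ltxx in lst.
suff : cos `|r%:R * (t - s)| < 1 by rewrite cos_norm c1 ltxx.
move: dlt dge; set d := `|_| => dlt dge.
rewrite -(divfK (_ : 2 != 0) d)// mulr_natr cos_mulr2n cos2sin2.
have : 0 < sin (d / 2).
  by apply: sin_gt0_pi; rewrite divr_gt0//= ltr_pdivrMr// mulr_natr.
by move=> sd; rewrite mulr2n; nra.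
Qed.

(** The product of the distances from [v] to the [r]-th roots of [Y] is
    [|v ^+ r - Y|]. *)
Lemma root_near (R : realType) (r : nat) (v Y : R[i]) : (0 < r)%N ->
  exists2 w, w ^+ r = Y & normc (w - v) ^+ r <= normc (Y - v ^+ r).
Proof.
move=> r0.
have [rs rsE] := closed_field_poly_normal ('X^r - Y%:P : {poly R[i]}).
move: rsE; rewrite lead_coefXnsubC// scale1r => rsE.
have szrs : size rs = r.
  by apply/succn_inj; rewrite -(size_prod_XsubC rs id) -rsE size_XnsubC.
have rts w : w \in rs -> w ^+ r = Y.
  rewrite -root_prod_XsubC -rsE rootE !hornerE subr_eq0.
  by move/eqP.
have valE : v ^+ r - Y = \prod_(w <- rs) (v - w).
  have := congr1 (fun p => p.[v]) rsE.
  rewrite /= !hornerE horner_prod => ->.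
  by apply: eq_bigr => w _; rewrite hornerXsubC.
have nE : normc (Y - v ^+ r) = \prod_(w <- rs) normc (w - v).
  rewrite normcB valE; elim: {rsE szrs rts valE} rs => [|w ws IH].
    by rewrite !big_nil normc1.
  by rewrite !big_cons normcM IH normcB.
have [/hasP[w wrs wle]|/hasPn far] :=
  boolP (has (fun w => normc (w - v) ^+ r <= normc (Y - v ^+ r)) rs).
  by exists w => //; exact: rts.
exfalso.
have N0 := normc_ge0 (Y - v ^+ r).
have : \prod_(w <- rs) normc (Y - v ^+ r) < \prod_(w <- rs) normc (w - v) ^+ r.
  rewrite big_seq [ltRHS]big_seq; apply: ltr_prod.
    case: rs szrs {rsE rts valE nE far} => [/= h|w ws _];
      first by rewrite -h in r0.
    by apply/hasP; exists w; rewrite mem_head.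
  by move=> w /far; rewrite -ltNge N0.
rewrite prodrXl -nE big_const_seq count_predT szrs -Monoid.iteropE /=.
by rewrite -/(_ ^+ r) ltxx.
Qed.
(** The choice among conjugate principal roots is immaterial: they have the
    same real part and the same modulus. *)
Definition proot (R : realType) (r : nat) (Y : R[i]) : R[i] :=
  xget 0 [set v | v ^+ r = Y /\ principal r v].

Lemma prootP (R : realType) (r : nat) (Y : R[i]) : (0 < r)%N ->
  proot r Y ^+ r = Y /\ principal r (proot r Y).
Proof.
move=> r0; have [v vY pv] := ex_principal_root Y r0.
by rewrite /proot; case: xgetP => [w _ //|/(_ v)[]].
Qed.

Lemma Re_proot (R : realType) (r : nat) (v : R[i]) : (0 < r)%N ->
  re v <= re (proot r (v ^+ r)).
Proof. by move=> r0; have [pE pp] := prootP (v ^+ r) r0;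
  apply: principal_max pp _. Qed.

Lemma continuous_of_expr (R : realType) (r : nat) (F : R[i] -> R) :
  (0 < r)%N -> (forall Y Z, `|F Z - F Y| ^+ r <= normc (Z - Y)) -> continuous F.
Proof.
move=> r0 FP Y A [e /= e0 eA]; apply/nbhs_normcP; exists (e ^+ r).
  exact: exprn_gt0.
move=> Z YZ; apply: eA; rewrite /ball_/= distrC.
by rewrite -(ltr_pXn2r r0) ?nnegrE ?(ltW e0)//; exact: le_lt_trans YZ.
Qed.

(** By [root_near] each of [Y] and [Z] has a root close to the principal root
    of the other one, and principal roots are the right-most ones. *)
Lemma continuous_Re_proot (R : realType) (r : nat) : (0 < r)%N ->
  continuous (fun Y : R[i] => re (proot r Y)).
Proof.
move=> r0; apply: continuous_of_expr (r0) _.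
have h (Y Z : R[i]) : re (proot r Y) <= re (proot r Z) ->
    `|re (proot r Z) - re (proot r Y)| ^+ r <= normc (Z - Y).
  move=> YZ; rewrite ger0_norm ?subr_ge0//.
  have [zE _] := prootP Z r0.
  have [w wY] := root_near (proot r Z) Y r0.
  rewrite zE [normc (w - _)]normcB [normc (Y - Z)]normcB => wZ;
    apply: le_trans wZ.
  have wle := Re_proot w r0; rewrite wY in wle.
  rewrite ler_pXn2r ?nnegrE ?subr_ge0 ?normc_ge0//.
  rewrite (le_trans _ (ler_Re_normc _))// cReB (le_trans _ (ler_norm _))//.
  by rewrite lerD2l lerN2.
move=> Y Z; have [|/ltW] := leP (re (proot r Y)) (re (proot r Z));
  first exact: h.
by rewrite distrC normcB; exact: h.
Qed.

Lemma continuous_normc_proot (R : realType) (r : nat) : (0 < r)%N ->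
  continuous (fun Y : R[i] => normc (proot r Y)).
Proof.
move=> r0; apply: continuous_of_expr (r0) _ => Y Z.
have [zE _] := prootP Z r0; have [yE _] := prootP Y r0.
have [w wY] := root_near (proot r Z) Y r0.
  rewrite zE [normc (w - _)]normcB [normc (Y - Z)]normcB => wZ;
    apply: le_trans wZ.
have <- : normc w = normc (proot r Y) by apply: (normc_root r0); rewrite wY yE.
rewrite ler_pXn2r ?nnegrE ?normc_ge0//.
exact: ler_normcB.
Qed.

(** The right-most root decides whether some root of [Y] lies in the disc
    [|v|^2 <= Re v]: all roots have the same modulus. *)
Definition gap (R : realType) (r : nat) (Y : R[i]) : R :=
  normc (proot r Y) ^+ 2 - re (proot r Y).

Lemma continuous_gap (R : realType) (r : nat) : (0 < r)%N ->
  continuous (@gap R r).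
Proof.
move=> r0; rewrite (_ : @gap R r = fun Y => normc (proot r Y) *
  normc (proot r Y) - re (proot r Y)); last by apply/funext => Y;
    rewrite -expr2.
move=> Y; have cn := continuous_normc_proot r0 (x := Y).
exact: (@continuousB R R R[i] _ _ Y (@continuousM R R[i] _ _ Y cn cn)
  (continuous_Re_proot r0 (x := Y))).
Qed.

Lemma gap_le (R : realType) (r : nat) (v : R[i]) : (0 < r)%N ->
  gap r (v ^+ r) <= normc v ^+ 2 - re v.
Proof.
move=> r0; have [pE _] := prootP (v ^+ r) r0.
by rewrite /gap (normc_root r0 pE) lerD2l lerN2 Re_proot.
Qed.

Lemma gap_principal (R : realType) (r : nat) (v : R[i]) : (0 < r)%N ->
  principal r v -> gap r (v ^+ r) = normc v ^+ 2 - re v.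
Proof.
move=> r0 pv; have [pE _] := prootP (v ^+ r) r0.
rewrite /gap (normc_root r0 pE); congr (_ - _); apply/eqP.
by rewrite eq_le Re_proot// andbT; apply: principal_max pv pE.
Qed.

(** * The stability region in the variable of the roots *)

Definition kap (R : realType) (delta : R) : R := 2 / (2 - delta).

Lemma kap_gt1 (R : realType) (delta : R) : 0 < delta <= 1 -> 1 < kap delta.
Proof. by move=> d01; rewrite /kap ltr_pdivlMr; lra. Qed.

Lemma kapE (R : realType) (delta : R) : 0 < delta <= 1 ->
  kap delta * (2 - delta) = 2.
Proof. by move=> d01; rewrite /kap divfK// gt_eqF//; lra. Qed.

(** [v = (zeta - 1) / (kap * (zeta - 1 + delta))] maps the unit circle to the
    circle [|v|^2 = Re v], and its exterior to the interior of that circle. *)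
Lemma disc_unit (R : realType) (delta : R) (zeta v : R[i]) :
  0 < delta <= 1 ->
  zeta - 1 = (kap delta)%:C * v * (zeta - 1 + delta%:C) ->
  delta * (normc zeta ^+ 2 - 1) =
  2 * kap delta * normc (zeta - 1 + delta%:C) ^+ 2 * (re v - normc v ^+ 2).
Proof.
move=> d01 vE; have kE := kapE d01; move: (kap delta) vE kE => k.
rewrite !normc_sqr; case: zeta v => [p q] [x y] [].
rewrite /= !(mul0r, mulr0, subr0, addr0, oppr0).
move=> e1 e2 kE.
have -> : delta * (p ^+ 2 + q ^+ 2 - 1) =
  2 * ((p - 1) * (p - 1 + delta) + q * q) -
  (2 - delta) * ((p - 1) ^+ 2 + q ^+ 2) by ring.
have -> : (p - 1) * (p - 1 + delta) + q * q =
  k * x * ((p - 1 + delta) ^+ 2 + q ^+ 2).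
  by rewrite {1}e1 {3}e2; ring.
have -> : (p - 1) ^+ 2 + q ^+ 2 =
  k ^+ 2 * (x ^+ 2 + y ^+ 2) * ((p - 1 + delta) ^+ 2 + q ^+ 2).
  by rewrite {1}e1 {2}e2; ring.
set N := (p - 1 + delta) ^+ 2 + q ^+ 2; have -> : (2 - delta) * (k ^+ 2 * (x ^+
  2 + y ^+ 2) * N) =
  k * (2 - delta) * (k * (x ^+ 2 + y ^+ 2) * N) by ring.
by rewrite kE; ring.
Qed.

Lemma kap_neq0 (R : realType) (delta : R) : 0 < delta <= 1 ->
  (kap delta)%:C != 0.
Proof.
move=> d01; rewrite (_ : 0 = 0%:C)// (inj_eq (@complexI _)) gt_eqF//.
exact: lt_trans ltr01 (kap_gt1 d01).
Qed.

Lemma cpol_bpolE (R : realType) (r : nat) (delta : R) (mu zeta v : R[i]) :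
  zeta - 1 = (kap delta)%:C * v * (zeta - 1 + delta%:C) ->
  cpol r delta zeta - mu * bpol r delta zeta =
  (zeta - 1 + delta%:C) ^+ r *
    (1 - mu * (1 - (kap delta)%:C ^+ r * v ^+ r)).
Proof.
move=> vE; rewrite /bpol /cpol (_ : (zeta - 1) ^+ r =
  (kap delta)%:C ^+ r * v ^+ r * (zeta - 1 + delta%:C) ^+ r); first by ring.
by rewrite {1}vE !exprMn.
Qed.

Lemma DminftyE (R : realType) (r : nat) (delta : R) (mu : R[i]) :
  0 < delta <= 1 ->
  Dminfty r delta mu <->
  forall v : R[i], normc v ^+ 2 <= re v ->
    mu * (1 - (kap delta)%:C ^+ r * v ^+ r) != 1.
Proof.
move=> d01; have k0 := kap_neq0 d01; have k1 := kap_gt1 d01.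
have dC0 : delta%:C != 0.
  by rewrite (_ : 0 = 0%:C)// (inj_eq (@complexI _)) gt_eqF//; case/andP: d01.
split=> [Dmu v vdisc|Dv zeta cb].
- apply/eqP => muv.
  have kv1 : 1 - (kap delta)%:C * v != 0.
    rewrite subr_eq0 eq_sym; apply/eqP => kv.
    by move: muv; rewrite -exprMn kv expr1n subrr mulr0 => /esym/eqP;
      rewrite oner_eq0.
  pose zeta := 1 - delta%:C + delta%:C / (1 - (kap delta)%:C * v).
  have vE : zeta - 1 = (kap delta)%:C * v * (zeta - 1 + delta%:C).
    by rewrite /zeta; field.
  have /Dmu : cpol r delta zeta - mu * bpol r delta zeta = 0.
    by rewrite (cpol_bpolE _ _ vE) muv subrr mulr0.
  rewrite normcR (_ : 1 = 1%:C)// ltcR => z1.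
  have := disc_unit d01 vE.
  suff : 0 <= re v - normc v ^+ 2.
    move=> g0 e; have n0 := sqr_ge0 (normc (zeta - 1 + delta%:C)).
    have kk : 0 <= 2 * kap delta by lra.
    have : 0 <= delta * (normc zeta ^+ 2 - 1).
      by rewrite e (mulr_ge0 (mulr_ge0 kk n0) g0).
    by case/andP: d01 => d0 _; rewrite pmulr_rge0// subr_ge0 expr_ge1//
      ?normc_ge0// leNgt z1.
  by rewrite subr_ge0.
- rewrite normcR (_ : 1 = 1%:C)// ltcR ltNge; apply/negP => z1.
  have a0 : zeta - 1 + delta%:C != 0.
    apply/eqP => a0; have zE : zeta = (1 - delta)%:C.
      rewrite rmorphB rmorph1 -[RHS]add0r -a0; ring.
    by move: z1; rewrite zE normcC ger0_norm; lra.
  pose v := (zeta - 1) / ((kap delta)%:C * (zeta - 1 + delta%:C)).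
  have vE : zeta - 1 = (kap delta)%:C * v * (zeta - 1 + delta%:C).
    by rewrite /v; field; rewrite a0 k0.
  have := disc_unit d01 vE.
  have n0 : 0 < normc (zeta - 1 + delta%:C) ^+ 2.
    by rewrite exprn_gt0// normc_gt0.
  move=> e; have vdisc : normc v ^+ 2 <= re v.
    rewrite -subr_ge0.
    have k20 : 0 < 2 * kap delta * normc (zeta - 1 + delta%:C) ^+ 2.
      by apply: mulr_gt0 => //; lra.
    rewrite -(pmulr_rge0 _ k20) -e mulr_ge0//; first by lra.
    by rewrite subr_ge0 -(expr1n _ 2) ler_pXn2r// ?nnegrE ?normc_ge0.
  move: cb; rewrite (cpol_bpolE _ _ vE) => /eqP; rewrite mulf_eq0 expf_eq0.
  rewrite (negbTE a0) andbF /= subr_eq0 eq_sym => /eqP.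
  by apply/eqP/Dv.
Qed.
(** The shape of the region depends only on [r] and on [K = kap delta ^+ r]; see
    [DminftyE]. *)
Definition region (R : realType) (r : nat) (K : R) : set R[i] :=
  [set mu | forall v : R[i], normc v ^+ 2 <= re v ->
     mu * (1 - K%:C * v ^+ r) != 1].

(** The value [v ^+ r] of the solutions of [mu * (1 - K * v ^+ r) = 1]. *)
Definition rootpow (R : realType) (K : R) (mu : R[i]) : R[i] :=
  (1 - mu^-1) / K%:C.

Lemma cos_piV_ge0 (R : realType) (r : nat) : (1 < r)%N ->
  0 <= cos (pi / r%:R : R).
Proof.
move=> r1; have pi0 := pi_ge0 R; have r0 := ltnW r1.
apply: cos_ge0_pihalf; apply/andP; split.
  by rewrite (@le_trans _ _ 0)// ?divr_ge0// oppr_le0 divr_ge0.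
by rewrite ler_pM2l ?pi_gt0// lef_pV2 ?posrE ?ltr0n// ler_nat.
Qed.

Lemma cos_piV_gt0 (R : realType) (r : nat) : (2 < r)%N ->
  0 < cos (pi / r%:R : R).
Proof.
move=> r2; have pi0 := pi_gt0 R; have r0 : (0 < r)%N by exact: ltn_trans r2.
apply: cos_gt0_pihalf; apply/andP; split.
  by rewrite (@lt_trans _ _ 0)// ?divr_gt0 ?ltr0n// oppr_lt0 divr_gt0.
by rewrite ltr_pM2l// ltf_pV2 ?posrE ?ltr0n// ltr_nat.
Qed.

Lemma cos_piV_le0 (R : realType) (r : nat) : (0 < r <= 2)%N ->
  cos (pi / r%:R : R) <= 0.
Proof.
case: r => [|[|[|]]]// _; first by rewrite divr1 cospi; lra.
by rewrite cos_pihalf.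
Qed.

(** The modulus of the end points of [root_arc]. For [r = 1] every number is
    principal, and the arc is the whole circle, closing up at 0. *)
Definition cosr (R : realType) (r : nat) : R :=
  if r == 1%N then 0 else cos (pi / r%:R).

Lemma cosr_ge0 (R : realType) (r : nat) : (0 < r)%N -> 0 <= cosr R r.
Proof.
move=> r0; rewrite /cosr; case: ifPn => // r1; apply: cos_piV_ge0.
by rewrite ltn_neqAle eq_sym r1.
Qed.

(** The points of the circle [|v|^2 = Re v] that are principal roots; on this
    circle that condition is a lower bound for the modulus. The point 0, which
    is its own principal root, belongs to the arc for [r <= 2] only. *)
Definition root_arc (R : realType) (r : nat) : set R[i] :=
  [set v | normc v ^+ 2 = re v /\ cosr R r ^+ 2 <= re v].

Section Region.
Variables (R : realType) (r : nat) (K : R).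
Hypotheses (r0 : (0 < r)%N) (K1 : 1 < K).

Let K0 : 0 < K. Proof. exact: lt_trans ltr01 K1. Qed.

Let KC0 : K%:C != 0. Proof. by rewrite realC_eq0 gt_eqF. Qed.

Lemma region0 : region r K 0.
Proof. by move=> v _; rewrite mul0r eq_sym oner_eq0. Qed.

Lemma region_neq1 (mu : R[i]) : region r K mu -> mu != 1.
Proof.
move=> Dmu; apply/eqP => mu1; have := Dmu 0.
by rewrite mu1 normc0 expr0n lexx expr0n gtn_eqF// mulr0 subr0 mulr1 eqxx =>
  /(_ isT).
Qed.

Lemma rootpowP (mu : R[i]) : mu != 0 -> mu * (1 - K%:C * rootpow K mu) = 1.
Proof. by move=> mu0; rewrite /rootpow mulrC [K%:C * _]mulrC divfK// subKr
  mulVf. Qed.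

Lemma rootpow_uniq (mu Y : R[i]) : mu * (1 - K%:C * Y) = 1 -> Y = rootpow K mu.
Proof.
move=> muY; have mu0 : mu != 0.
  by apply: contra_eq_neq muY => ->; rewrite mul0r eq_sym oner_eq0.
have := rootpowP mu0; rewrite -[RHS]muY => /(mulfI mu0).
by move=> /addrI/oppr_inj/(mulfI KC0).
Qed.

Lemma region_gap (mu : R[i]) : mu != 0 ->
  region r K mu <-> 0 < gap r (rootpow K mu).
Proof.
move=> mu0; split=> [Dmu|g0 v vdisc].
- have [pE _] := prootP (rootpow K mu) r0.
  rewrite /gap subr_gt0 ltNge; apply/negP => /Dmu.
  by rewrite pE rootpowP ?eqxx.
- apply/eqP => /rootpow_uniq vY; have := gap_le v r0.
  by rewrite vY; lra.
Qed.

Lemma continuous_rootpow (mu : R[i]) : mu != 0 ->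
  {for mu, continuous (rootpow K)}.
Proof.
move=> mu0; apply: continuousCM; last exact: cst_continuous.
apply: continuousCB; first exact: cst_continuous.
by apply: continuousCV => //; exact: cvg_id.
Qed.

Lemma continuous_gap_rootpow (mu : R[i]) : mu != 0 ->
  {for mu, continuous (gap r \o rootpow K)}.
Proof.
move=> mu0; apply: continuous_comp; first exact: continuous_rootpow.
exact: continuous_gap.
Qed.

Lemma nbhs_region (mu : R[i]) : region r K mu -> nbhs mu (region r K).
Proof.
move=> Dmu; have [->|mu0] := eqVneq mu 0.
- have K10 : 0 < 1 + K by rewrite addr_gt0.
  apply/nbhs_normcP; exists (1 + K)^-1; first by rewrite invr_gt0.
  move=> w; rewrite subr0 => wK v vdisc.
  apply/eqP => /(congr1 (@normc R)); rewrite normcM normc1.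
  have v1 : normc v <= 1.
    have nn : normc v ^+ 2 <= normc v.
      by rewrite (le_trans vdisc)// (le_trans (ler_norm _))// ler_Re_normc.
    move: nn (normc_ge0 v); move: (normc v : R) => n; nra.
  have n1 : normc (1 - K%:C * v ^+ r) <= 1 + K.
    rewrite (le_trans (le_normcD _ _))// normc1 lerD2l normcN normcM normcC.
    rewrite gtr0_norm// (ler_piMr (ltW K0))//.
    by rewrite normcX exprn_ile1// normc_ge0.
  move: wK; rewrite -[X in _ < X]mul1r ltr_pdivlMr// => wK.
  move=> wn; have : normc w * normc (1 - K%:C * v ^+ r) <= normc w * (1 + K).
    by rewrite ler_wpM2l// normc_ge0.
  by rewrite wn leNgt wK.
- have gp : 0 < gap r (rootpow K mu) by apply/region_gap.
  have h := nbhsCI (nbhs_neq0 mu0)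
    (nbhs_continuous_gt (continuous_gap_rootpow mu0) gp).
  by apply: filterS h => w [w0 gw]; apply/region_gap.
Qed.

Lemma region_open : open (region r K).
Proof. by rewrite openE; exact: nbhs_region. Qed.

Lemma closure_region_gap (mu : R[i]) : mu != 0 -> closure (region r K) mu ->
  0 <= gap r (rootpow K mu).
Proof.
move=> mu0 cl; rewrite leNgt; apply/negP => gn.
have [w [Dw [w0]]] := cl _ (nbhsCI (nbhs_neq0 mu0)
    (nbhs_continuous_lt (continuous_gap_rootpow mu0) gn)).
by move/(region_gap w0): Dw => /= ? ?; lra.
Qed.

Lemma root_arc_principal (v : R[i]) : root_arc r v -> principal r v.
Proof.
move=> [vc]; rewrite /cosr /principal; have n0 := normc_ge0 v.
have [r2|r2] := leqP r 2.
  by move=> _; rewrite -vc (@le_trans _ _ 0) ?sqr_ge0// mulr_ge0_le0//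
    cos_piV_le0 ?r0.
rewrite gtn_eqF ?(ltn_trans _ r2)// -vc => cn.
rewrite expr2 ler_wpM2l// -(ler_pXn2r (n := 2))// nnegrE.
exact: cos_piV_ge0 (ltnW r2).
Qed.

(** Otherwise [v ^+ r = K^-1] would also have a positive root [y < 1]. As
    [re v = |v|^2 = y^2 < y], that root would be to the right of [v]. *)
Lemma root_arc_pole (v : R[i]) : root_arc r v -> 1 - K%:C * v ^+ r != 0.
Proof.
move=> av; have pv := root_arc_principal av; case: av => vc _.
rewrite subr_eq0; apply/eqP => Kv.
have iK : 0 < K^-1 by rewrite invr_gt0.
have [y y0 yE] := ex_real_root r0 (ltW iK).
have yv : y%:C ^+ r = v ^+ r.
  by apply: (mulfI KC0); rewrite -Kv -rmorphXn yE -rmorphM mulfV ?gt_eqF.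
have := principal_max r0 pv yv; rewrite -vc -(normc_root r0 yv) normcC
  ger0_norm//=.
have y1 : y < 1.
  by rewrite -(expr_lt1 r0)// yE invf_lt1.
have yp : 0 < y.
  rewrite lt_neqAle y0 andbT; apply: contraTneq iK => y00.
  by rewrite -yE -y00 expr0n gtn_eqF// ltxx.
nra.
Qed.
(** A path that leaves the disc through principal roots stays in the region:
    when a principal root is outside of the disc, all conjugate roots are. *)
Lemma closure_of_path (W : R -> R[i]) : {for 0, continuous W} ->
  1 - K%:C * W 0 ^+ r != 0 ->
  (forall s, 0 < s -> principal r (W s) /\ re (W s) < normc (W s) ^+ 2) ->
  closure (region r K) (1 - K%:C * W 0 ^+ r)^-1.
Proof.
move=> cW W0 WP U.
pose m s := (1 - K%:C * W s ^+ r)^-1.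
have cm : {for 0, continuous m}.
  have cd : {for 0, continuous (fun s => 1 - K%:C * W s ^+ r)}.
    apply: continuousCB; first exact: cst_continuous.
    by apply: continuousCM; [exact: cst_continuous|exact: continuousCX].
  exact: (@continuousCV R R _ 0 W0 cd).
move=> /cm[e /= e0 eU].
have e20 : 0 < e / 2 by rewrite divr_gt0.
exists (m (e / 2)); split; last first.
  by apply: eU; rewrite /ball_/= sub0r normrN gtr0_norm// ltr_pdivrMr//; lra.
have [pW gW] := WP _ e20.
have [mE|mE] := eqVneq (1 - K%:C * W (e / 2) ^+ r) 0.
  by rewrite /m mE invr0; exact: region0.
apply/region_gap; first by rewrite invr_eq0.
rewrite -(_ : W (e / 2) ^+ r = rootpow K (m (e / 2))).
  by rewrite gap_principal// subr_gt0.
by apply: rootpow_uniq; rewrite /m mulVf.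
Qed.

(** For [r > 2] the sector of the principal roots lies in the right half-plane,
    where all small numbers satisfy [|v|^2 <= Re v]. So near [mu = 1], which
    corresponds to [v = 0], there are no points of the region. *)
Lemma closure_region_neq1 : (2 < r)%N -> ~ closure (region r K) 1.
Proof.
move=> r2 cl; have c0 := cos_piV_gt0 R r2.
have one0 : 1 != 0 :> R[i] by exact: oner_neq0.
have Y0 : rootpow K (1 : R[i]) = 0 by rewrite /rootpow invr1 subrr mul0r.
have p0 : normc (proot r (0 : R[i])) = 0.
  have [+ _] := prootP (0 : R[i]) r0.
  by move/(congr1 (@normc R)); rewrite normcX normc0 => /eqP;
    rewrite expf_eq0 r0 => /eqP.
have cN : {for 1, continuous (fun w : R[i] => normc (proot r (rootpow K w)))}.
  have cp := @continuous_normc_proot R r r0 (rootpow K 1).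
  exact: (@continuous_comp R[i] R[i] R _ _ 1 (continuous_rootpow one0) cp).
have lN : normc (proot r (rootpow K 1)) < cos (pi / r%:R) by rewrite Y0 p0.
have [w [Dw [/= w0 wN]]] := cl _ (nbhsCI (nbhs_neq0 one0) (nbhs_continuous_lt
  cN lN)).
move/(region_gap w0): Dw; rewrite /gap subr_gt0.
have [_] := prootP (rootpow K w) r0; rewrite /principal => pp lt.
have := le_lt_trans pp lt; rewrite ltNge expr2 ler_wpM2l ?normc_ge0//.
exact: ltW.
Qed.

(** At a boundary point the continuous function [gap] vanishes, so the principal
    roots are on the circle. Conversely, scaling up a point of the arc pushes
    it out of the disc and keeps it principal; from 0 one leaves the disc along
    the imaginary axis instead. *)
Lemma boundary_region :
  boundary (region r K) = [set (1 - K%:C * v ^+ r)^-1 | v in root_arc r].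
Proof.
rewrite /boundary (interior_id _).1; last exact: region_open.
apply/seteqP; split => [mu [cl Dmu]|_ [v va <-]] /=.
- have mu0 : mu != 0 by apply/eqP => mu0; apply: Dmu; rewrite mu0;
  exact: region0.
  have g0 : gap r (rootpow K mu) = 0.
    apply/eqP; rewrite eq_le closure_region_gap// andbT leNgt; apply/negP => g0.
    by apply: Dmu; apply/region_gap.
  have [pE pp] := prootP (rootpow K mu) r0.
  exists (proot r (rootpow K mu)); last first.
    by rewrite pE; apply: invr_inj; rewrite invrK; apply: (mulfI mu0);
      rewrite rootpowP// mulfV.
  move: g0 pp pE; rewrite /gap; move: (proot _ _) => v /eqP.
  rewrite subr_eq0 => /eqP vc pp pE; split => //.
  rewrite /cosr; case: ifPn => [_|r1]; first by rewrite expr0n -vc sqr_ge0.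
  have r2 : (1 < r)%N by rewrite ltn_neqAle eq_sym r1.
  have [v0|v0] := eqVneq v 0.
    have [r3|] := leqP r 2; last first.
      move/closure_region_neq1 => []; suff -> : 1 = mu by [].
      move: (rootpowP mu0); rewrite -pE v0 expr0n gtn_eqF// mulr0 subr0 mulr1.
      by move->.
    by rewrite v0 (_ : r = 2%N) ?cos_pihalf ?expr0n//; apply/eqP;
      rewrite eqn_leq r3.
  have n0 : 0 < normc v by rewrite normc_gt0.
  move: pp; rewrite /principal -vc expr2 ler_pM2l// => cn.
  by rewrite -expr2 ler_pXn2r ?nnegrE ?normc_ge0 ?cos_piV_ge0.
- have v1 := root_arc_pole va; have pv := root_arc_principal va;
  case: (va) => vc vb.
  split; last first.
    by move/(_ v); rewrite vc lexx mulVf ?eqxx// => /(_ isT).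
  have [v0|v0] := eqVneq v 0.
  + have r2 : (r <= 2)%N.
      rewrite leqNgt; apply/negP => r3; move: vb.
      rewrite v0 /cosr gtn_eqF ?(ltn_trans _ r3)//= leNgt.
      by rewrite exprn_gt0// cos_piV_gt0.
    pose W s : R[i] := s%:C * 'i%C.
    have WE : W 0 = v by rewrite /W mul0r v0.
    have W0 : 1 - K%:C * W 0 ^+ r != 0 by rewrite WE.
    rewrite -WE; apply: (@closure_of_path W _ W0).
    * by apply: continuousCM; [exact: continuous_realC|exact: cst_continuous].
    * move=> s s0; rewrite /principal /W normcM normcC (gtr0_norm s0) cReZ /=.
      rewrite expr0n add0r expr1n sqrtr1 !mulr1 mulr0 exprn_gt0//; split=> //.
      exact: mulr_ge0_le0 (ltW s0) (cos_piV_le0 R (introT andP (conj r0 r2))).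
  + pose W s : R[i] := (1 + s)%:C * v.
    have WE : W 0 = v by rewrite /W addr0 mul1r.
    have W0 : 1 - K%:C * W 0 ^+ r != 0 by rewrite WE.
    rewrite -WE; apply: (@closure_of_path W _ W0).
    * apply: continuousCM; last exact: cst_continuous.
      apply: (continuous_comp (g := fun x : R => x%:C));
        last exact: continuous_realC.
      by apply: (@continuousD _ R); [exact: cst_continuous|exact: cvg_id].
    * move=> s s0; have s1 : 0 < 1 + s by rewrite addr_gt0.
      rewrite /principal /W normcM normcC (gtr0_norm s1) cReZ -mulrA.
      rewrite (ler_pM2l s1) -/(principal r v); split=> //.
      rewrite exprMn expr2 -mulrA ltr_pM2l// vc ltr_pMl; first by rewrite ltrDl.
      by rewrite -vc exprn_gt0// normc_gt0.
Qed.
End Region.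

(** * Simple connectedness *)

Lemma within_continuous_comp (T U V : topologicalType) (S : set T) (A : set U)
    (f : T -> U) (g : U -> V) :
  {within S, continuous f} -> f @` S `<=` A ->
  (forall x, A x -> {for x, continuous g}) -> {within S, continuous (g \o f)}.
Proof.
move=> /subspace_continuousP cf fA cg; apply/subspace_continuousP => x Sx.
apply: (cvg_comp _ _ (cf x Sx)); apply: cg; apply: fA; by exists x.
Qed.

(** A loop of [B] is lifted to [A] by [g], contracted there, and the contraction
    is pushed down to [B] by [f]. *)
Lemma simply_connected_retract (R : realType) (A B : set R[i]) (f g : R[i] ->
  R[i]) :
  (forall x, A x -> {for x, continuous f}) ->
  (forall y, B y -> {for y, continuous g}) ->
  (forall x, A x -> B (f x)) -> (forall y, B y -> A (g y) /\ f (g y) = y) ->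
  simply_connected A -> simply_connected B.
Proof.
move=> cf cg fB gA [pA hA]; split.
- move=> x y Bx By; have [Ax fx] := gA _ Bx; have [Ay fy] := gA _ By.
  have [p [cp pI p0 p1]] := pA _ _ Ax Ay; exists (f \o p); split.
  + exact: within_continuous_comp cp pI cf.
  + by move=> _ [t It <-]; apply: fB; apply: pI; exists t.
  + by rewrite /= p0.
  + by rewrite /= p1.
- move=> p cp pB p01.
  have [||/=|H [cH HA H0 H1 Hs]] := hA (g \o p).
  + exact: within_continuous_comp cp pB cg.
  + by move=> _ [t It <-]; apply: (gA _ _).1; apply: pB; exists t.
  + by rewrite p01.
  have fg t : t \in unit_itv R -> f (g (p t)) = p t.
    by move=> It; apply: (gA _ _).2; apply: pB; exists t => //;
      rewrite inE in It.
  have I0 : 0 \in unit_itv R by rewrite inE /unit_itv /= in_itv /= lexx ler01.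
  exists (f \o H); split.
  + exact: within_continuous_comp cH HA cf.
  + by move=> _ [t It <-]; apply: fB; apply: HA; exists t.
  + by move=> t It; rewrite /= H0//= fg.
  + by move=> t It; rewrite /= H1//= fg.
  + by move=> s Is; have [h0 h1] := Hs _ Is; rewrite /= h0 h1 /= fg.
Qed.

Definition clamp (R : realType) (t : R) : R := Num.max 0 (Num.min 1 t).

Lemma clamp_itv (R : realType) (t : R) : unit_itv R (clamp t).
Proof. by rewrite /unit_itv /= in_itv /= /clamp le_max lexx ge_max ler01 ge_min
  lexx. Qed.

Lemma clamp_id (R : realType) (t : R) : unit_itv R t -> clamp t = t.
Proof.
by rewrite /unit_itv /= in_itv /= /clamp => /andP[t0 t1];
  rewrite (min_r t1) (max_r t0).
Qed.

Lemma clamp_le0 (R : realType) (t : R) : t <= 0 -> clamp t = 0.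
Proof. by move=> t0; rewrite /clamp max_l// ge_min t0 orbT. Qed.

Lemma clamp_ge1 (R : realType) (t : R) : 1 <= t -> clamp t = 1.
Proof. by move=> t0; rewrite /clamp min_l// max_r. Qed.

Lemma continuous_clamp (R : realType) : continuous (@clamp R).
Proof.
move=> t; apply: continuousRmax; first exact: cst_continuous.
by apply: continuousRmin; [exact: cst_continuous|exact: cvg_id].
Qed.

Lemma continuous_clamp_comp (R : realType) (p : R -> R[i]) :
  {within unit_itv R, continuous p} -> continuous (p \o @clamp R).
Proof.
move=> /subspace_continuousP cp t A nA.
have [e e0 eA] := continuous_clamp (cp _ (clamp_itv t) A nA).
by exists e => // s /eA; apply; exact: clamp_itv.
Qed.

Section Star.
Variables (R : realType) (A : set R[i]).
Hypothesis starA : forall (s : R) x, 0 <= s <= 1 -> A x -> A (s%:C * x).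

Let itvP (t : R) : unit_itv R t -> 0 <= t <= 1.
Proof. by rewrite /unit_itv /= in_itv. Qed.

(** The shape of the homotopy contracting a loop [p] at [x]. While [s <= 1/2],
    the loop runs along the ray from [x] towards the centre, goes around a
    shrunken copy of [p], and comes back; at [s = 1/2] it goes straight to the
    centre and back. Then this path retreats to [x]. The parameters below are
    the scaling factor, the time in [p], and the correction that stops the
    descent at height [2 s - 1]. *)
Definition phase1 (s : R) : R := Num.min (2 * s) 1.
Definition phase2 (s : R) : R := Num.max (2 * s - 1) 0.
Definition scaling (st : R * R) : R :=
  1 - Num.min (phase1 st.1) (Num.min ((1 + 2 * phase1 st.1) * st.2)
                               ((1 + 2 * phase1 st.1) * (1 - st.2))).
Definition looptime (st : R * R) : R :=
  (1 + 2 * phase1 st.1) * st.2 - phase1 st.1.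
Definition correction (st : R * R) : R :=
  Num.max (phase2 st.1 - scaling st) 0.

Definition star_homotopy (p : R -> R[i]) (st : R * R) : R[i] :=
  (scaling st)%:C * p (clamp (looptime st)) + (correction st)%:C * p 0.

Lemma continuous_phase1 : continuous (fun st : R * R => phase1 st.1).
Proof.
rewrite /phase1 => st; apply: (@continuousRmin R (R * R)%type);
  last exact: cst_continuous.
by apply: (@continuousRM R (R * R)%type); [exact: cst_continuous|exact:
  cvg_fst].
Qed.

Lemma continuous_phase2 : continuous (fun st : R * R => phase2 st.1).
Proof.
rewrite /phase2 => st; apply: (@continuousRmax R (R * R)%type);
  last exact: cst_continuous.
apply: (@continuousRB R (R * R)%type); last exact: cst_continuous.
by apply: (@continuousRM R (R * R)%type); [exact: cst_continuous|exact:
  cvg_fst].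
Qed.

Let continuous_speed : continuous (fun st : R * R => 1 + 2 * phase1 st.1).
Proof.
move=> st; apply: (@continuousRD R (R * R)%type); first exact: cst_continuous.
by apply: (@continuousRM R (R * R)%type); [exact: cst_continuous|exact:
  continuous_phase1].
Qed.

Lemma continuous_scaling : continuous scaling.
Proof.
rewrite /scaling => st; apply: (@continuousRB R (R * R)%type);
  first exact: cst_continuous.
apply: (@continuousRmin R (R * R)%type); first exact: continuous_phase1.
apply: (@continuousRmin R (R * R)%type); apply: (@continuousRM R (R * R)%type);
  try exact: continuous_speed.
  exact: cvg_snd.
by apply: (@continuousRB R (R * R)%type); [exact: cst_continuous|exact:
  cvg_snd].
Qed.

Lemma continuous_looptime : continuous looptime.
Proof.
rewrite /looptime => st; apply: (@continuousRB R (R * R)%type);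
  last exact: continuous_phase1.
by apply: (@continuousRM R (R * R)%type); [exact: continuous_speed|exact:
  cvg_snd].
Qed.

Lemma continuous_correction : continuous correction.
Proof.
rewrite /correction => st; apply: (@continuousRmax R (R * R)%type);
  last exact: cst_continuous.
by apply: (@continuousRB R (R * R)%type); [exact: continuous_phase2|exact:
  continuous_scaling].
Qed.

Lemma star_path_connected : path_connected A.
Proof.
move=> x y Ax Ay.
exists (fun t : R => (Num.max (1 - 2 * t) 0)%:C * x + (Num.max (2 * t - 1)
  0)%:C * y).
split.
- apply: continuous_subspaceT => t.
  have cl : {for t, continuous (fun t : R => 2 * t)}.
    by apply: (@continuousRM R R); [exact: cst_continuous|exact: cvg_id].
  apply: (@continuousCD R R); apply: (@continuousCM R R);
    try exact: cst_continuous.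
    apply: (@continuous_comp R R R[i] (fun t : R => Num.max (1 - 2 * t) 0));
      last exact: continuous_realC.
    apply: (@continuousRmax R R); last exact: cst_continuous.
    by apply: (@continuousRB R R); first exact: cst_continuous.
  apply: (@continuous_comp R R R[i] (fun t : R => Num.max (2 * t - 1) 0));
    last exact: continuous_realC.
  apply: (@continuousRmax R R); last exact: cst_continuous.
  by apply: (@continuousRB R R); last exact: cst_continuous.
- move=> _ [t /itvP /andP[t0 t1] <-].
  have [h|h] := leP (2 * t) 1.
    rewrite (max_r (_ : 2 * t - 1 <= 0)) ?subr_le0// mul0r addr0.
    by apply: starA => //; rewrite max_l; lra.
  rewrite (max_r (_ : 1 - 2 * t <= 0)) ?subr_le0 ?(ltW h)// mul0r add0r.
  by apply: starA => //; rewrite max_l; lra.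
- by rewrite mulr0 subr0 sub0r max_l// max_r ?lerN10// mul1r mul0r addr0.
- rewrite mulr1 max_r; last by lra.
  by rewrite max_l; [rewrite (_ : 2 - 1 = 1);
    [rewrite mul0r mul1r add0r|lra]|lra].
Qed.

Lemma star_homotopy_continuous (p : R -> R[i]) :
  {within unit_itv R, continuous p} -> continuous (star_homotopy p).
Proof.
move=> cp st; apply: (@continuousCD R (R * R)%type);
  apply: (@continuousCM R (R * R)%type); last exact: cst_continuous.
- by apply: (@continuous_comp _ R R[i] scaling);
  [exact: continuous_scaling|exact: continuous_realC].
- apply: (@continuous_comp _ R R[i] looptime (p \o @clamp R)).
    exact: continuous_looptime.
  exact: continuous_clamp_comp.
- by apply: (@continuous_comp _ R R[i] correction);
  [exact: continuous_correction|exact: continuous_realC].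
Qed.

(** The only case that needs thought is the second phase: there [p] is only
    traversed while the scaling factor vanishes. *)
Lemma star_homotopy_sub (p : R -> R[i]) : p @` unit_itv R `<=` A -> p 0 = p 1 ->
  star_homotopy p @` (unit_itv R `*` unit_itv R) `<=` A.
Proof.
move=> pA p01 _ [[s t] [/= /itvP/andP[s0 s1] /itvP/andP[t0 t1]] <-].
have pAt u : A (p (clamp u)) by apply: pA; exists (clamp u) => //;
  exact: clamp_itv.
have Ap0 : A (p 0) by rewrite -(@clamp_le0 R 0)//; exact: pAt.
rewrite /star_homotopy.
have sc01 : 0 <= scaling (s, t) <= 1.
  rewrite /scaling /=; set a := phase1 s.
  have a0 : 0 <= a <= 1 by rewrite /a /phase1 le_min ge_min lexx orbT; lra.
  set b := (1 + 2 * a) * t; set c := (1 + 2 * a) * (1 - t).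
  have b0 : 0 <= b by rewrite mulr_ge0//; lra.
  have c0 : 0 <= c by rewrite mulr_ge0//; lra.
  have m0 : 0 <= Num.min a (Num.min b c) by rewrite !le_min b0 c0; lra.
  have m1 : Num.min a (Num.min b c) <= 1 by rewrite ge_min; lra.
  lra.
have [h|h] := leP (2 * s) 1.
  have -> : correction (s, t) = 0.
    rewrite /correction /phase2 /= (max_r (_ : 2 * s - 1 <= 0)) ?subr_le0//
      sub0r.
    by rewrite max_r// oppr_le0; case/andP: sc01.
  by rewrite mul0r addr0; apply: starA.
have -> : (scaling (s, t))%:C * p (clamp (looptime (s, t))) =
          (scaling (s, t))%:C * p 0.
  have a1 : phase1 s = 1 by rewrite /phase1 min_r ?ltW.
  rewrite /scaling /looptime /= a1.
  have [h1|h1] := leP ((1 + 2 * 1) * t) 1; first by rewrite clamp_le0//; lra.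
  have [h2|h2] := leP 2 ((1 + 2 * 1) * t).
    by rewrite clamp_ge1 ?p01//; lra.
  rewrite [Num.min 1 _]min_l ?subrr ?mul0r// le_min; apply/andP; split; lra.
rewrite -mulrDl -rmorphD; apply: starA => //.
rewrite /correction addr_maxr addr0 addrC subrK /phase2 /=.
rewrite [Num.max (2 * s - 1) 0]max_l; last by lra.
case/andP: sc01 => sc0 sc1; rewrite le_max sc0 orbT/= ge_max sc1 andbT; lra.
Qed.

Lemma star_simply_connected : simply_connected A.
Proof.
split; first exact: star_path_connected.
move=> p cp pA p01; exists (star_homotopy p).
have itv0 : unit_itv R 0 by rewrite /unit_itv /= in_itv /= lexx ler01.
split.
- exact/continuous_subspaceT/star_homotopy_continuous.
- exact: star_homotopy_sub.
- move=> t; rewrite inE => It; have /andP[t0 t1] := itvP It.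
  rewrite /star_homotopy /scaling /looptime /correction /scaling /phase1
    /phase2 /=.
  rewrite mulr0 (min_l (ler01 : 0 <= 1 :> R)) !mulr0 addr0 !mul1r subr0.
  rewrite [Num.min 0 _]min_l ?le_min ?t0 ?subr_ge0// subr0 mul1r clamp_id//.
  by rewrite sub0r (max_r (lerN10 R)) sub0r (max_r (lerN10 R)) mul0r addr0.
- move=> t; rewrite inE => It; have /andP[t0 t1] := itvP It.
  rewrite /star_homotopy /correction /looptime /scaling /phase1 /phase2 /=
    mulr1.
  rewrite (min_r (_ : 1 <= 2)) ?mulr1; last by lra.
  rewrite (max_l (_ : 0 <= 2 - 1)); last by lra.
  set m := Num.min 1 _; have m0 : 0 <= m.
    by rewrite !le_min ler01 !mulr_ge0 ?subr_ge0//; lra.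
  rewrite [Num.max _ 0]max_l; last by lra.
  have -> : (1 - m)%:C * p (clamp ((1 + 2) * t - 1)) = (1 - m)%:C * p 0.
    rewrite /m; have [h1|h1] := leP ((1 + 2) * t) 1;
      first by rewrite clamp_le0//; lra.
    have [h2|h2] := leP 2 ((1 + 2) * t); first by rewrite clamp_ge1 ?p01//; lra.
    by rewrite min_l ?subrr ?mul0r// le_min; apply/andP; split; lra.
  rewrite -mulrDl -rmorphD (_ : 1 - m + _ = 1) ?mul1r//; lra.
- move=> s; rewrite inE => Is; have /andP[s0 s1] := itvP Is.
  have a0 : 0 <= phase1 s by rewrite /phase1 le_min; apply/andP; split; lra.
  have b1 : phase2 s <= 1 by rewrite /phase2 ge_max; apply/andP; split; lra.
  have a1 : 0 <= 1 + 2 * phase1 s by lra.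
  rewrite /star_homotopy /correction /looptime /scaling /= !(subrr, subr0,
    mulr0, mulr1).
  rewrite (min_l a1) (min_r a1) (min_r a0) !subr0 sub0r.
  rewrite (max_r (_ : phase2 s - 1 <= 0)) ?subr_le0// mul0r addr0 !mul1r.
  rewrite clamp_le0 ?oppr_le0//; split=> //.
  rewrite clamp_ge1; [by rewrite addr0 p01|lra].
Qed.
End Star.

(** The involution [mu / (mu - 1)]. In terms of the roots [v] it is, up to the
    factor [K], the value [v ^- r]; scaling it down moves all roots away from
    the origin, and so out of the disc [|v|^2 <= Re v] more than before. *)
Definition pole_invol (R : realType) (mu : R[i]) : R[i] := mu / (mu - 1).

Lemma pole_involK (R : realType) (mu : R[i]) : mu != 1 -> pole_invol
  (pole_invol mu) = mu.
Proof.
rewrite -subr_eq0 => mu1; rewrite /pole_invol.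
have -> : mu / (mu - 1) - 1 = (mu - 1)^-1 by field.
by rewrite invrK divfK.
Qed.

Lemma pole_invol_neq1 (R : realType) (mu : R[i]) : mu != 1 -> pole_invol mu !=
  1.
Proof.
rewrite -subr_eq0 => mu1; rewrite -subr_eq0 /pole_invol.
have -> : mu / (mu - 1) - 1 = (mu - 1)^-1 by field.
by rewrite invr_eq0.
Qed.

Lemma continuous_pole_invol (R : realType) (mu : R[i]) : mu != 1 ->
  {for mu, continuous (@pole_invol R)}.
Proof.
rewrite -subr_eq0 => mu1; apply: (@continuousCM R R[i]); first exact: cvg_id.
apply: (@continuousCV R R[i]) => //; apply: (@continuousCB R R[i]).
  exact: cvg_id.
exact: cst_continuous.
Qed.

Lemma region_simply_connected (R : realType) (r : nat) (K : R) :
  (0 < r)%N -> 1 < K -> simply_connected (region r K).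
Proof.
move=> r0 K1; have K0 : 0 < K by rewrite (lt_trans ltr01).
have KC0 : K%:C != 0 by rewrite realC_eq0 gt_eqF.
pose E := [set x : R[i] | x != 1 /\ region r K (pole_invol x)].
apply: (@simply_connected_retract R E _ (@pole_invol R) (@pole_invol R)).
- by move=> x [x1 _]; exact: continuous_pole_invol.
- by move=> y /(region_neq1 r0) y1; exact: continuous_pole_invol.
- by move=> x [].
- move=> y Dy; have y1 := region_neq1 r0 Dy; rewrite /E /= pole_involK//;
  split=> //.
  by split=> //; exact: pole_invol_neq1.
apply: star_simply_connected => s x s01 [x1 Dx].
set mu := pole_invol x in Dx.
have xE : x = pole_invol mu by rewrite pole_involK.
have mu1 : mu != 1 by exact: pole_invol_neq1.
have mu10 : mu - 1 != 0 by rewrite subr_eq0.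
case/andP: s01 => s0 s1.
have [q q0 qE] := ex_real_root r0 s0.
have q1 : q <= 1 by rewrite -(expr_le1 r0 q0) qE.
(* [s x] corresponds to the roots [v / q]; both claims exhibit a root in the
   disc for [mu] itself *)
have Dq (v : R[i]) : normc v ^+ 2 <= re v -> mu * (1 - K%:C * s%:C * v ^+ r) !=
  1.
  move=> vdisc; rewrite -mulrA -qE rmorphXn -exprMn; apply: Dx.
  rewrite normcM normcC ger0_norm// cReZ exprMn expr2 -mulrA ler_wpM2l//.
  by rewrite (le_trans _ vdisc)// ler_piMl// sqr_ge0.
have den : 1 - (1 - s%:C) * mu != 0.
  have iK : 0 <= K^-1 by rewrite invr_ge0 ltW.
  have [y y0 yE] := ex_real_root r0 iK.
  have y1 : y <= 1 by rewrite -(expr_le1 r0 y0) yE invf_le1 ?ltW.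
  have : normc y%:C ^+ 2 <= re y%:C.
    by rewrite normcC ger0_norm//= expr2 ler_piMl.
  move/Dq; apply: contra; rewrite -rmorphXn yE fmorphV.
  have -> : mu * (1 - K%:C * s%:C * K%:C^-1) = (1 - s%:C) * mu by field.
  by rewrite subr_eq0 eq_sym.
rewrite /E /=.
have sx1 : s%:C * x - 1 = (1 - (1 - s%:C) * mu) / (mu - 1).
  by rewrite xE /pole_invol; field.
split; first by rewrite -subr_eq0 sx1 mulf_neq0 ?invr_eq0.
have -> : pole_invol (s%:C * x) = s%:C * mu / (1 - (1 - s%:C) * mu).
  by rewrite /pole_invol sx1 xE /pole_invol; field; rewrite mu10 den.
move=> v vdisc; apply: contra (Dq v vdisc) => /eqP h; apply/eqP.
have {}h : s%:C * mu * (1 - K%:C * v ^+ r) = 1 - (1 - s%:C) * mu.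
  by rewrite -[LHS](divfK den) [X in X * _]mulrAC h mul1r.
have -> : mu * (1 - K%:C * s%:C * v ^+ r) =
  s%:C * mu * (1 - K%:C * v ^+ r) + (1 - s%:C) * mu by ring.
by rewrite h subrK.
Qed.

(** * The boundary curve *)

(** The argument is measured from the positive axis, so that lying between
    [arg z0] and [2 pi - arg z0] means lying to the left of [z0]. *)
Lemma param_arcP (R : realType) (r : nat) (delta : R) :
  normc (zstart r delta) = 1 -> 0 <= im (zstart r delta) ->
  param_arc r delta =
  [set z | normc z = 1 /\ re z <= re (zstart r delta)].
Proof.
rewrite /param_arc; move: (zstart r delta) => z0 n0 i0; have pi0 := pi_gt0 R.
have reb (z : R[i]) : normc z = 1 -> -1 <= re z <= 1.
  by move=> <-; rewrite -ler_norml ler_Re_normc.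
have cE (z : R[i]) : normc z = 1 ->
    carg z = if 0 <= im z then acos (re z) else 2 * pi - acos (re z).
  by move=> nz; rewrite /carg normcR nz /= divr1.
rewrite (cE _ n0) i0; set t0 := acos _.
have ct0 : cos t0 = re z0 by rewrite acosK// in_itv/= reb.
have t00 : 0 <= t0 by rewrite acos_ge0 ?reb.
have t0pi : t0 <= pi by rewrite acos_lepi ?reb.
apply/seteqP; split => [_ [t + <-]|z [nz zz0]] /=.
- rewrite /= in_itv /= => /andP[tl tu]; split; first exact: normc_expi.
  rewrite -ct0; have [tpi|tpi] := leP t pi.
    by rewrite ler_cos// in_itv/= ?t00 ?tpi ?(le_trans t00)//=.
  have -> : cos t = cos (2 * pi - t).
    by rewrite -[RHS]cosN opprB mulr_natl -(cosD2pi (t - _)) subrK.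
  by rewrite ler_cos// ?in_itv/=; lra.
- have z_neq0 : z != 0 by rewrite -normc_eq0 nz oner_eq0.
  have [/andP[c0 c1] zE] := cargP z_neq0.
  exists (carg z); last by rewrite {2}zE normcR nz mul1r.
  rewrite /= in_itv /= (cE _ nz).
  have a0 : t0 <= acos (re z).
    rewrite -ler_cos ?in_itv/= ?t00 ?t0pi ?acos_ge0 ?acos_lepi ?reb//.
    by rewrite ct0 acosK// in_itv/= reb.
  have api : acos (re z) <= pi by rewrite acos_lepi ?reb.
  by case: ifP => _; apply/andP; split; lra.
Qed.

Section Curve.
Variables (R : realType) (r : nat) (delta : R).
Hypotheses (r0 : (0 < r)%N) (d01 : 0 < delta <= 1).

Let k := kap delta.
Let K := k ^+ r.

Let k1 : 1 < k. Proof. exact: kap_gt1. Qed.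

Lemma kapX_gt1 : 1 < kap delta ^+ r.
Proof. by rewrite exprn_egt1// -lt0n. Qed.

Lemma Dminfty_region : Dminfty r delta = region r K.
Proof.
by apply/seteqP; split => mu; rewrite (DminftyE _ _ d01) /region /= /K rmorphXn.
Qed.

Lemma kv_neq1 (v : R[i]) : root_arc r v -> 1 - k%:C * v != 0.
Proof.
move=> av; have := root_arc_pole r0 kapX_gt1 av; apply: contra.
by rewrite !subr_eq0 => /eqP kv; rewrite rmorphXn -exprMn -kv expr1n.
Qed.

Lemma kC_E : k%:C = 2 / (2 - delta%:C).
Proof. by rewrite /k /kap fmorph_div rmorphB rmorph_nat. Qed.

Lemma unit_shift_neq0 (z : R[i]) : normc z = 1 -> z - 1 + delta%:C != 0.
Proof.
move=> nz; apply/eqP => a0.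
have zE : z = (1 - delta)%:C.
  by rewrite rmorphB rmorph1 -[RHS]add0r -a0; ring.
by move: nz; rewrite zE normcC ger0_norm; have := d01; lra.
Qed.

Lemma curveE (z v : R[i]) : z - 1 + delta%:C != 0 ->
  z - 1 = k%:C * v * (z - 1 + delta%:C) ->
  curve r delta z = (1 - K%:C * v ^+ r)^-1.
Proof.
move=> a0 vE; rewrite /curve /bpol /cpol (_ : (z - 1) ^+ r =
  K%:C * v ^+ r * (z - 1 + delta%:C) ^+ r).
  set A := (z - 1 + delta%:C) ^+ r; have A0 : A != 0 by rewrite expf_neq0.
  have -> : A - K%:C * v ^+ r * A = (1 - K%:C * v ^+ r) * A by ring.
  by rewrite invfM mulrCA mulfV ?mulr1.
by rewrite {1}vE !exprMn /K rmorphXn.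
Qed.

Lemma circle_unit (z v : R[i]) : z - 1 + delta%:C != 0 ->
  z - 1 = k%:C * v * (z - 1 + delta%:C) ->
  normc z = 1 <-> normc v ^+ 2 = re v.
Proof.
move=> a0 vE; have := disc_unit d01 vE.
have n0 : 0 < normc (z - 1 + delta%:C) ^+ 2.
  by rewrite exprn_gt0// normc_gt0.
have dn0 : delta != 0 by rewrite gt_eqF//; have := d01; lra.
have kn0 : 2 * kap delta * normc (z - 1 + delta%:C) ^+ 2 != 0.
  by rewrite gt_eqF// mulr_gt0//; have := k1; rewrite /k; lra.
move=> e; split=> [nz|vc].
- move/eqP: e; rewrite nz expr1n subrr mulr0 eq_sym mulf_eq0 (negbTE kn0) /=.
  by rewrite subr_eq0 => /eqP.
- move/eqP: e; rewrite vc subrr mulr0 mulf_eq0 (negbTE dn0) /= subr_eq0.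
  by rewrite sqrp_eq1 ?normc_ge0// => /eqP.
Qed.

(** On the circles [|z| = 1] and [|v|^2 = re v], the number
    [re v = |z - 1|^2 / (k * |z - 1 + delta|)^2] is a decreasing homographic
    function of [re z]. *)
Lemma ler_Re_circle (z v z' v' : R[i]) : normc z = 1 -> normc z' = 1 ->
  z - 1 = k%:C * v * (z - 1 + delta%:C) ->
  z' - 1 = k%:C * v' * (z' - 1 + delta%:C) ->
  (re z <= re z') = (re v' <= re v).
Proof.
have h (w u : R[i]) : normc w = 1 ->
    w - 1 = k%:C * u * (w - 1 + delta%:C) ->
    0 < k ^+ 2 * (delta ^+ 2 + 2 * (1 - delta) * (1 - re w)) /\
    re u = 2 * (1 - re w) / (k ^+ 2 * (delta ^+ 2 + 2 * (1 - delta) * (1 - re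
      w))).
  move=> nw uE.
  have := unit_shift_neq0 nw => a0.
  have n2 : re w ^+ 2 + im w ^+ 2 = 1 by rewrite -normc_sqr nw expr1n.
  have aE : normc (w - 1 + delta%:C) ^+ 2 =
      delta ^+ 2 + 2 * (1 - delta) * (1 - re w).
    rewrite normc_sqr; case: w n2 {nw uE a0} => x y /= n2.
    have y2 : y ^+ 2 = 1 - x ^+ 2 by rewrite -n2; ring.
    by rewrite oppr0 !addr0 y2; ring.
  have wE : normc (w - 1) ^+ 2 = 2 * (1 - re w).
    rewrite normc_sqr; case: w n2 {nw uE a0 aE} => x y /= n2.
    have y2 : y ^+ 2 = 1 - x ^+ 2 by rewrite -n2; ring.
    by rewrite oppr0 !addr0 y2; ring.
  have kp : 0 < k by rewrite (lt_trans ltr01).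
  have pos : 0 < k ^+ 2 * (delta ^+ 2 + 2 * (1 - delta) * (1 - re w)).
    by rewrite -aE mulr_gt0 ?exprn_gt0// normc_gt0.
  split=> //; apply: (mulIf (lt0r_neq0 pos)); rewrite divfK ?gt_eqF//.
  have -> : re u = normc u ^+ 2 by apply/esym/(circle_unit a0 uE).
  have e2 : normc (w - 1) ^+ 2 =
      k ^+ 2 * normc u ^+ 2 * normc (w - 1 + delta%:C) ^+ 2.
    by rewrite {1}uE !normcM normcC (gtr0_norm kp) !exprMn.
  by rewrite -aE -wE e2; ring.
move=> nz nz' vE vE'; have [p e] := h _ _ nz vE; have [p' e'] := h _ _ nz' vE'.
rewrite e e' ler_pdivrMr// mulrAC ler_pdivlMr//.
have kp : 0 < k ^+ 2 by rewrite exprn_gt0// (lt_trans ltr01).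
rewrite ![_ * (k ^+ 2 * _)]mulrCA (ler_pM2l kp) -subr_ge0.
rewrite (_ : _ - _ = 2 * delta ^+ 2 * (re z' - re z)); last by ring.
rewrite pmulr_rge0 ?subr_ge0// mulr_gt0// exprn_gt0//.
by case/andP: d01.
Qed.

(** The common end point of the arcs: the value of [v] at [z = z0], see [zstartE]. *)
Definition vstart : R[i] := (cosr R r)%:C * expi (pi / r%:R).

Lemma vstartX : vstart ^+ r = - (cosr R r ^+ r)%:C.
Proof.
rewrite exprMn expiX mulrCA mulfV ?mulr1; last by rewrite pnatr_eq0 -lt0n.
by rewrite /expi cospi sinpi -rmorphXn complexr0 rmorphN rmorph1 mulrN1.
Qed.

Lemma Re_vstart : re vstart = cosr R r ^+ 2.
Proof.
rewrite /vstart cReZ /= /cosr; case: ifP => _; first by rewrite mul0r expr0n.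
by rewrite expr2.
Qed.

Lemma normc_vstart : normc vstart = cosr R r.
Proof. by rewrite /vstart normcM normcC normc_expi mulr1 ger0_norm// cosr_ge0.
  Qed.

Lemma root_arc_vstart : root_arc r vstart.
Proof. by split; rewrite ?normc_vstart Re_vstart. Qed.

Lemma zstart_vstart : (2 - delta%:C - 2 * vstart != 0) /\
  zstart r delta = (2 - delta%:C - 2 * (1 - delta%:C) * vstart) /
                   (2 - delta%:C - 2 * vstart).
Proof.
have d2 : 0 < 2 - delta by have := d01; lra.
have d2C : 2 - delta%:C = (2 - delta)%:C by rewrite rmorphB rmorph_nat.
have d20 : 2 - delta%:C != 0 :> R[i] by rewrite d2C realC_eq0 gt_eqF.
split.
- have -> : 2 - delta%:C - 2 * vstart = (2 - delta%:C) * (1 - k%:C * vstart).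
    by rewrite kC_E; field.
  by rewrite mulf_neq0// kv_neq1//; exact: root_arc_vstart.
- rewrite /zstart /vstart /cosr; case: ifP => // _.
  by rewrite mul0r !mulr0 !subr0 divff.
Qed.

Lemma zstartE : zstart r delta - 1 + delta%:C != 0 /\
  zstart r delta - 1 = k%:C * vstart * (zstart r delta - 1 + delta%:C).
Proof.
have [n0 ->] := zstart_vstart.
have d2 : 0 < 2 - delta by have := d01; lra.
have d2C : 2 - delta%:C != 0 :> R[i].
  by rewrite -[2](rmorph_nat (real_complex R)) -rmorphB realC_eq0 gt_eqF.
have dC0 : delta%:C != 0 by rewrite realC_eq0 gt_eqF//; have := d01; lra.
have -> : (2 - delta%:C - 2 * (1 - delta%:C) * vstart) /
          (2 - delta%:C - 2 * vstart) - 1 + delta%:C =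
          delta%:C * (2 - delta%:C) / (2 - delta%:C - 2 * vstart) by field.
split; first by rewrite !mulf_neq0// invr_eq0.
by rewrite kC_E; field; rewrite n0 d2C.
Qed.

Lemma zstart_unit : normc (zstart r delta) = 1.
Proof.
have [a0 zE] := zstartE; apply/(circle_unit a0 zE).
by rewrite normc_vstart Re_vstart.
Qed.

Lemma Im_zstart_ge0 : 0 <= im (zstart r delta).
Proof.
have [n0 zE] := zstart_vstart; have pi0 := pi_ge0 R.
have iv : 0 <= im vstart.
  rewrite /vstart cImM /= mul0r addr0 mulr_ge0 ?cosr_ge0//.
  exact/sin_ge0_pi/piV_bounds.
have : zstart r delta * (2 - delta%:C - 2 * vstart) =
       2 - delta%:C - 2 * (1 - delta%:C) * vstart by rewrite zE divfK.
move: (zstart r delta) vstart iv n0 {zE} => [p q] [x y] /= y0 n0 [].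
rewrite !(mul0r, mulr0, subr0, addr0, oppr0, add0r, sub0r) => eR eI.
set a := 2 - delta - 2 * x in eR eI.
have N0 : 0 < a ^+ 2 + (2 * y) ^+ 2.
  rewrite lt_neqAle addr_ge0 ?sqr_ge0// andbT eq_sym; apply: contra n0.
  rewrite paddr_eq0 ?sqr_ge0// !sqrf_eq0 => /andP[/eqP a0 /eqP y20].
  apply/eqP/complex_ext => /=; rewrite ?(mul0r, mulr0, subr0, addr0, oppr0).
    by rewrite -[RHS]a0 /a; ring.
  by rewrite -y20; lra.
rewrite -(pmulr_lge0 _ N0).
have -> : q * (a ^+ 2 + (2 * y) ^+ 2) =
  a * (p * (- (2 * y)) + q * a) + 2 * y * (p * a - q * (- (2 * y))) by ring.
have -> : p * (- (2 * y)) + q * a = - (2 * (1 - delta) * y) by move: eI; lra.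
have -> : p * a - q * (- (2 * y)) = 2 - delta - 2 * (1 - delta) * x.
  by move: eR; lra.
rewrite (_ : _ + _ = 2 * y * (delta * (2 - delta))); last by rewrite /a; ring.
by rewrite !mulr_ge0//; have := d01; lra.
Qed.

Lemma curve_param_arc :
  [set curve r delta z | z in param_arc r delta] =
  [set (1 - K%:C * v ^+ r)^-1 | v in root_arc r].
Proof.
have [a0 zE] := zstartE.
have kC0 : k%:C != 0 by exact: kap_neq0.
rewrite (param_arcP zstart_unit Im_zstart_ge0).
apply/seteqP; split => [_ [z [nz zz0] <-]|_ [v av <-]] /=.
- have az := unit_shift_neq0 nz.
  pose v := (z - 1) / (k%:C * (z - 1 + delta%:C)).
  have vE : z - 1 = k%:C * v * (z - 1 + delta%:C).
    by rewrite /v; field; rewrite az kC0.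
  exists v; last by rewrite (curveE az vE).
  split; first exact/(circle_unit az vE).
  by rewrite -Re_vstart -(ler_Re_circle nz zstart_unit vE zE).
- have kv1 := kv_neq1 av.
  have dC0 : delta%:C != 0 by rewrite realC_eq0 gt_eqF//; have := d01; lra.
  pose z := 1 - delta%:C + delta%:C / (1 - k%:C * v).
  have aE : z - 1 + delta%:C = delta%:C / (1 - k%:C * v) by rewrite /z; ring.
  have az : z - 1 + delta%:C != 0 by rewrite aE mulf_neq0 ?invr_eq0.
  have vE : z - 1 = k%:C * v * (z - 1 + delta%:C) by rewrite /z; field.
  have nz : normc z = 1 by apply/(circle_unit az vE); case: av.
  exists z; last exact: curveE.
  split=> //; rewrite (ler_Re_circle nz zstart_unit vE zE) Re_vstart.
  by case: av.
Qed.
End Curve.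

(** * Extremal points *)

(** [v] is a root of [X^2 - 2 re v X + |v|^2]. *)
Lemma Re_exprSS (R : realType) (v : R[i]) n :
  re (v ^+ n.+2) = 2 * re v * re (v ^+ n.+1) - normc v ^+ 2 * re (v ^+ n).
Proof.
rewrite normc_sqr !exprS; case: v (v ^+ n) => [x y] [a b] /=; ring.
Qed.

Lemma Re_expr_circle (R : realType) (v : R[i]) (c : R) :
  re v = c -> normc v ^+ 2 = c ->
  [/\ re (v ^+ 2) = 2 * c ^+ 2 - c, re (v ^+ 3) = 4 * c ^+ 3 - 3 * c ^+ 2,
      re (v ^+ 4) = 8 * c ^+ 4 - 8 * c ^+ 3 + c ^+ 2 &
      re (v ^+ 5) = 16 * c ^+ 5 - 20 * c ^+ 4 + 5 * c ^+ 3].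
Proof.
move=> rc nc.
have e2 : re (v ^+ 2) = 2 * c ^+ 2 - c.
  by rewrite Re_exprSS expr0 expr1 rc nc /=; ring.
have e3 : re (v ^+ 3) = 4 * c ^+ 3 - 3 * c ^+ 2.
  by rewrite Re_exprSS e2 expr1 rc nc; ring.
have e4 : re (v ^+ 4) = 8 * c ^+ 4 - 8 * c ^+ 3 + c ^+ 2.
  by rewrite Re_exprSS e3 e2 rc nc; ring.
by split=> //; rewrite Re_exprSS e4 e3 rc nc; ring.
Qed.

(** Since [vstart ^+ r = - cosr ^+ r], the formulas of [Re_expr_circle] for
    [c = cosr ^+ 2] become polynomial equations satisfied by [cosr]. *)
Lemma cosr_values (R : realType) :
  [/\ cosr R 1 = 0, cosr R 2 = 0, 2 * cosr R 3 = 1, 2 * cosr R 4 ^+ 2 = 1 &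
      4 * cosr R 5 ^+ 2 = 2 * cosr R 5 + 1].
Proof.
have q0 r : (2 < r)%N -> 0 < cosr R r.
  move=> r2; rewrite /cosr gtn_eqF ?(ltn_trans _ r2)//=.
  exact: cos_piV_gt0.
have rel r : (2 < r)%N -> let c := cosr R r ^+ 2 in
    re (vstart R r ^+ r) = - cosr R r ^+ r /\
    [/\ re (vstart R r ^+ 2) = 2 * c ^+ 2 - c,
        re (vstart R r ^+ 3) = 4 * c ^+ 3 - 3 * c ^+ 2,
        re (vstart R r ^+ 4) = 8 * c ^+ 4 - 8 * c ^+ 3 + c ^+ 2 &
        re (vstart R r ^+ 5) = 16 * c ^+ 5 - 20 * c ^+ 4 + 5 * c ^+ 3].
  move=> r2; have r0 : (0 < r)%N by case: r r2.
  split; first by rewrite vstartX.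
  by apply: Re_expr_circle; rewrite ?Re_vstart ?normc_vstart.
split.
- by rewrite /cosr eqxx.
- by rewrite /cosr /= cos_pihalf.
- have := q0 3%N isT; have [//|] := rel 3%N;
  move: (cosr R 3) => q -> [_ h _ _] qp.
  have : q ^+ 3 * ((q + 1) * (2 * q - 1) ^+ 2) = 0 by move: h; nra.
  move/eqP; rewrite mulf_eq0 expf_eq0 /= (gt_eqF qp) /= mulf_eq0 sqrf_eq0.
  by rewrite gt_eqF ?addr_gt0//= subr_eq0 => /eqP.
- have := q0 4%N isT; have [//|] := rel 4%N;
  move: (cosr R 4) => q -> [_ _ h _] qp.
  have : q ^+ 4 * (2 * q ^+ 2 - 1) ^+ 2 = 0 by move: h; nra.
  move/eqP; rewrite mulf_eq0 expf_eq0 /= (gt_eqF qp) /= sqrf_eq0.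
  by rewrite subr_eq0 => /eqP.
- have := q0 5%N isT; have [//|] := rel 5%N;
  move: (cosr R 5) => q -> [_ _ _ h] qp.
  have : q ^+ 5 * ((q + 1) * (4 * q ^+ 2 - 2 * q - 1) ^+ 2) = 0 by move: h; nra.
  move/eqP; rewrite mulf_eq0 expf_eq0 /= (gt_eqF qp) /= mulf_eq0 sqrf_eq0.
  by rewrite gt_eqF ?addr_gt0//= => /eqP; lra.
Qed.

(** For [v != 0] the first inequality says that [v ^- r] has real part at most 1,
    the second one that it lies in the disc with diameter [- cosr ^- r, 1] (a
    half-plane when [cosr] is 0). This is where the bound on [r] enters. In each
    case both are polynomial inequalities in [re v], the second one having the
    end points [1] and [cosr ^+ 2] of the range of [re v] as roots. *)
Lemma root_arc_ineq (R : realType) (r : nat) (v : R[i]) : (1 <= r <= 5)%N ->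
  root_arc r v ->
  re (v ^+ r) <= re v ^+ r /\
  (1 - cosr R r ^+ r) * re (v ^+ r) <= re v ^+ r - cosr R r ^+ r.
Proof.
move=> r15 [nv].
have cle1 : re v <= 1.
  have := ler_norm (re v); have := ler_Re_normc v; have := normc_ge0 v.
  move: nv; move: (normc v : R) => n; nra.
have [e2 e3 e4 e5] := Re_expr_circle erefl nv.
have [q1 q2 q3 q4 q5] := cosr_values R.
have q50 := @cosr_ge0 R 5 isT.
case: r r15 => [|[|[|[|[|[|]]]]]]// _; move: (re v) cle1 e2 e3 e4 e5 => c cle1
  e2 e3 e4 e5.
- by rewrite q1 !expr1 !subr0 mul1r.
- rewrite q2 e2 !expr0n /= => c0.
  have p1 : 0 <= c * (1 - c) by rewrite mulr_ge0//; lra.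
  split; lra.
- have -> : cosr R 3 = 1 / 2 by lra.
  rewrite e3 => c0.
  have p1 : 0 <= 3 * c ^+ 2 * (1 - c) by rewrite !mulr_ge0 ?sqr_ge0//; lra.
  have p2 : 0 <= (1 - c) * (4 * c - 1) * (5 * c + 1).
    by rewrite !mulr_ge0//; nra.
  split; lra.
- have -> : cosr R 4 ^+ 4 = 1 / 4.
    rewrite (_ : _ ^+ 4 = (2 * cosr R 4 ^+ 2) ^+ 2 / 4); last by field.
    by rewrite q4 expr1n.
  rewrite e4 => c0.
  have p1 : 0 <= c ^+ 2 * (1 - c) * (7 * c - 1).
    by rewrite !mulr_ge0 ?sqr_ge0//; nra.
  have p2 : 0 <= (1 - c) * (2 * c - 1) * (10 * c ^+ 2 + 3 * c + 1).
    by rewrite !mulr_ge0//; nra.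
  split; lra.
- move: (cosr R 5) q5 q50 => q q5 q50 c0.
  have q2' : q ^+ 2 = (2 * q + 1) / 4 by lra.
  have qq : q * q = (2 * q + 1) / 4 by rewrite -expr2.
  have -> : q ^+ 5 = (10 * q + 3) / 32.
    have -> : q ^+ 5 = q ^+ 2 * q ^+ 2 * q by ring.
    have -> : q ^+ 2 * q ^+ 2 * q = (2 * q + 1) / 4 * (2 * q + 1) / 4 * q.
      by rewrite q2'; field.
    have -> : (2 * q + 1) / 4 * (2 * q + 1) / 4 * q =
      (4 * (q * q) * q + 4 * (q * q) + q) / 16 by field.
    rewrite qq; have -> : 4 * ((2 * q + 1) / 4) * q = 2 * (q * q) + q by field.
    by rewrite qq; field.
  have q34 : 3 / 4 <= q <= 1.
    apply/andP; split; rewrite leNgt; apply/negP => qlt.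
      have : 0 <= q * (3 / 4 - q) by rewrite mulr_ge0//; lra.
      by move: qq; lra.
    have : 0 <= q * (q - 1) by rewrite mulr_ge0//; lra.
    by move: qq; lra.
  have c14 : 9 / 16 <= c by rewrite (le_trans _ c0)// q2'; lra.
  rewrite e5.
  have p1 : 0 <= 5 * c ^+ 3 * (1 - c) * (3 * c - 1).
    by rewrite !mulr_ge0 ?exprn_ge0//; lra.
  have g0 : 0 <= (27 / 2 - 5 * q) * c ^+ 3 + (11 / 2 * q - 15 / 8) * c ^+ 2 +
                 (1 / 8 + 3 / 2 * q) * c + (1 / 8 + q / 2).
    by rewrite !addr_ge0// ?mulr_ge0 ?exprn_ge0//; lra.
  have p2 : 0 <= (1 - c) * (c - q ^+ 2) * 
     ((27 / 2 - 5 * q) * c ^+ 3 + (11 / 2 * q - 15 / 8) * c ^+ 2 +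
                 (1 / 8 + 3 / 2 * q) * c + (1 / 8 + q / 2)).
    by apply: mulr_ge0 => //; apply: mulr_ge0; lra.
  split; first lra.
  (* reduce the powers of [q] in the factorisation *)
  have qc j : q * q * c ^+ j = (2 * q + 1) / 4 * c ^+ j by rewrite qq.
  have := qc 0%N; have := qc 1%N; have := qc 2%N; have := qc 3%N;
    have := qc 4%N.
  by move: p2; rewrite q2'; lra.
Qed.

Section Extremal.
Variables (R : realType) (r : nat) (K : R).
Hypotheses (r15 : (1 <= r <= 5)%N) (K1 : 1 < K).

Let r0 : (0 < r)%N. Proof. by case/andP: r15. Qed.
Let K0 : 0 < K. Proof. exact: lt_trans ltr01 K1. Qed.

Definition root_curve : set R[i] :=
  [set (1 - K%:C * v ^+ r)^-1 | v in root_arc r].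

Lemma Re_mobius (Y : R[i]) : re (1 - K%:C * Y)^-1 =
  (1 - K * re Y) / (1 - 2 * K * re Y + K ^+ 2 * normc Y ^+ 2).
Proof.
rewrite cReV cReB cReZ /=; congr (_ / _).
by rewrite !normc_sqr cReB cImB cReZ cImM /=; ring.
Qed.

Lemma mobius_gt0 (Y : R[i]) : 1 - K%:C * Y != 0 ->
  0 < 1 - 2 * K * re Y + K ^+ 2 * normc Y ^+ 2.
Proof.
rewrite -normc_eq0 => Y0.
have -> : 1 - 2 * K * re Y + K ^+ 2 * normc Y ^+ 2 = normc (1 - K%:C * Y) ^+ 2.
  by rewrite !normc_sqr cReB cImB cReZ cImM /=; ring.
by rewrite exprn_gt0// lt_neqAle normc_ge0 andbT eq_sym.
Qed.

Lemma real_of_normc (Y : R[i]) (x : R) :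
  re Y = x -> normc Y ^+ 2 = x ^+ 2 -> Y = x%:C.
Proof.
move=> rY; rewrite normc_sqr rY => /eqP.
rewrite -subr_eq0 addrC addKr sqrf_eq0 => /eqP iY.
exact: complex_ext.
Qed.

Lemma normcX_sqr (v : R[i]) : root_arc r v -> normc (v ^+ r) ^+ 2 = re v ^+ r.
Proof. by move=> [nv _]; rewrite normcX exprAC nv. Qed.

(** Geometrically, [v ^- r] lies outside the disc with diameter [1, K]. *)
Lemma root_curve_left (v : R[i]) : root_arc r v ->
  (1 - K)^-1 <= re (1 - K%:C * v ^+ r)^-1 ?= iff (v ^+ r == 1).
Proof.
move=> av; have [AB _] := root_arc_ineq r15 av.
have N0 := mobius_gt0 (root_arc_pole r0 K1 av).
have Y1 : normc (v ^+ r) <= 1.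
  have nv1 : normc v <= 1.
    case: av => nv _; have : normc v ^+ 2 <= normc v.
      by rewrite nv (le_trans (ler_norm _))// ler_Re_normc.
    by have := normc_ge0 v; move: (normc v : R) => n; nra.
  by rewrite normcX exprn_ile1// normc_ge0.
rewrite Re_mobius -(normcX_sqr av) in AB *.
move: AB N0 Y1; move: (v ^+ r) => Y.
have B1 : re Y <= normc Y by rewrite (le_trans (ler_norm _))// ler_Re_normc.
have n0 := normc_ge0 Y.
move=> AB N0 Y1; have KN : 1 - K < 0 by rewrite subr_lt0.
have dE : (1 - K * re Y) / (1 - 2 * K * re Y + K ^+ 2 * normc Y ^+ 2) - (1 -
  K)^-1 =
   K * ((1 - re Y) + K * (normc Y ^+ 2 - re Y)) /
   ((1 - 2 * K * re Y + K ^+ 2 * normc Y ^+ 2) * (K - 1)).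
  move: (re Y) (normc Y : R) N0 => y n N0; field.
  by rewrite exprMn (gt_eqF N0) (lt_eqF KN) gt_eqF// subr_gt0.
have den0 : 0 < (1 - 2 * K * re Y + K ^+ 2 * normc Y ^+ 2) * (K - 1).
  by rewrite mulr_gt0// subr_gt0.
have R1 : 0 <= 1 - re Y by rewrite subr_ge0 (le_trans B1).
have R2 : 0 <= K * (normc Y ^+ 2 - re Y) by rewrite mulr_ge0 ?subr_ge0// ltW.
split.
  by rewrite -subr_ge0 dE divr_ge0 ?(ltW den0)// mulr_ge0 ?(ltW K0)// addr_ge0.
rewrite eq_sym -subr_eq0 dE mulf_eq0 invr_eq0 (gt_eqF den0) orbF.
rewrite mulf_eq0 (gt_eqF K0) /= paddr_eq0//.
apply/andP/eqP => [[/eqP e1]|->].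
  rewrite mulf_eq0 (gt_eqF K0)/= => /eqP e2.
  by apply: (@real_of_normc _ 1); rewrite ?expr1n; lra.
by rewrite normc1 expr1n /= subrr mulr0.
Qed.

(** Geometrically, [v ^- r] lies in the disc with diameter [- cosr ^- r, K],
    which contains the disc of [root_arc_ineq]. *)
Lemma root_curve_right (v : R[i]) : root_arc r v ->
  re (1 - K%:C * v ^+ r)^-1 <= (1 + K * cosr R r ^+ r)^-1
    ?= iff (v ^+ r == - (cosr R r ^+ r)%:C).
Proof.
move=> av; have [_ AB] := root_arc_ineq r15 av.
have N0 := mobius_gt0 (root_arc_pole r0 K1 av).
have s0 : 0 <= cosr R r ^+ r by rewrite exprn_ge0// cosr_ge0.
have sn : cosr R r ^+ r <= normc (v ^+ r).
  rewrite normcX lerXn2r ?nnegrE ?cosr_ge0 ?normc_ge0//.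
  by case: av => nv; rewrite -nv ler_pXn2r ?nnegrE ?cosr_ge0 ?normc_ge0.
rewrite Re_mobius -(normcX_sqr av) in AB *.
move: AB N0 sn s0; move: (cosr R r ^+ r) (v ^+ r) => s Y AB N0 sn s0.
have B1 : - re Y <= normc Y.
  by rewrite (le_trans _ (ler_Re_normc _))// -normrN ler_norm.
have n0 := normc_ge0 Y.
have Ks : 0 < 1 + K * s by rewrite ltr_pwDl// mulr_ge0// ltW.
have dE : (1 + K * s)^-1 - (1 - K * re Y) / (1 - 2 * K * re Y + K ^+ 2 * normc
  Y ^+ 2) =
   K * ((normc Y ^+ 2 - s - (1 - s) * re Y) + (K - 1) * (normc Y ^+ 2 + s * re
     Y)) /
   ((1 - 2 * K * re Y + K ^+ 2 * normc Y ^+ 2) * (1 + K * s)).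
  move: (re Y) (normc Y : R) N0 => y n N0; field.
  by rewrite exprMn (gt_eqF N0) (gt_eqF Ks).
have den0 : 0 < (1 - 2 * K * re Y + K ^+ 2 * normc Y ^+ 2) * (1 + K * s).
  by rewrite mulr_gt0.
have R1 : 0 <= normc Y ^+ 2 - s - (1 - s) * re Y by lra.
have T0 : normc Y * (normc Y - s) <= normc Y ^+ 2 + s * re Y.
  by have : 0 <= s * (normc Y + re Y); [rewrite mulr_ge0//; lra|lra].
have T1 : 0 <= normc Y * (normc Y - s) by rewrite mulr_ge0// subr_ge0.
have K10 : 0 < K - 1 by rewrite subr_gt0.
have R2 : 0 <= (K - 1) * (normc Y ^+ 2 + s * re Y).
  by rewrite mulr_ge0 ?(ltW K10)//; exact: le_trans T0.
split.
  by rewrite -subr_ge0 dE divr_ge0 ?(ltW den0)// mulr_ge0 ?(ltW K0)// addr_ge0.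
rewrite eq_sym -subr_eq0 dE mulf_eq0 invr_eq0 (gt_eqF den0) orbF.
rewrite mulf_eq0 (gt_eqF K0) /= paddr_eq0// -rmorphN.
apply/andP/eqP => [[/eqP e1]|->]; last first.
  by rewrite normcC normrN ger0_norm//=; split; apply/eqP; ring.
rewrite mulf_eq0 (gt_eqF K10)/= => /eqP e2.
have Bs : re Y = - s by move: e1 e2; lra.
apply: real_of_normc => //; rewrite Bs in e2.
by rewrite sqrrN; move: e2; lra.
Qed.

Lemma root_curve_point (v : R[i]) (x : R) : root_arc r v -> v ^+ r = x%:C ->
  root_curve ((1 - K * x)^-1)%:C.
Proof. by move=> av vx; exists v => //; rewrite vx fmorphV rmorphB rmorphM
  rmorph1. Qed.

Lemma root_arc1 : root_arc r (1 : R[i]).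
Proof.
split; rewrite ?normc1 ?expr1n//= expr_le1 ?cosr_ge0//.
by rewrite /cosr; case: ifP => _; rewrite ?ler01 ?cos_le1.
Qed.

Lemma leftmost_root_curve (m : R[i]) :
  leftmost root_curve m <-> m = ((1 - K)^-1)%:C.
Proof.
have Sl : root_curve ((1 - K)^-1)%:C.
  by rewrite -[K in 1 - K]mulr1; apply: root_curve_point root_arc1 _;
    rewrite expr1n.
split=> [[[v av <-] /(_ _ Sl) /= le]|->].
  have [le' eqv] := root_curve_left av.
  have /eqP -> : v ^+ r == 1 by rewrite -eqv eq_le le' le.
  by rewrite mulr1 fmorphV rmorphB rmorph1.
split=> // _ [v av <-]; exact: (root_curve_left av).1.
Qed.

Lemma rightmost_root_curve (m : R[i]) :
  rightmost root_curve m <-> m = ((1 + K * cosr R r ^+ r)^-1)%:C.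
Proof.
have Sl : root_curve ((1 + K * cosr R r ^+ r)^-1)%:C.
  rewrite -[K * _]opprK -mulrN; apply: (root_curve_point (root_arc_vstart R
    r0)).
  by rewrite vstartX// rmorphN.
split=> [[[v av <-] /(_ _ Sl) /= le]|->].
  have [le' eqv] := root_curve_right av.
  have /eqP -> : v ^+ r == - (cosr R r ^+ r)%:C by rewrite -eqv eq_le le' le.
  by rewrite mulrN opprK fmorphV rmorphD rmorphM rmorph1.
split=> // _ [v av <-]; exact: (root_curve_right av).1.
Qed.
End Extremal.

Theorem theorem4p3 (R : realType) (r : nat) (delta : R) :
  (1 <= r <= 5)%N -> 0 < delta <= 1 ->
  let D := Dminfty r delta in
  let z0 := zstart r delta in
  [/\ simply_connected D,
      D 0,
      boundary D = [set curve r delta z | z in param_arc r delta],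
      (exists! m : R[i], leftmost (boundary D) m) /\
      (exists! m : R[i], rightmost (boundary D) m) &
      forall ml mr : R[i],
        leftmost (boundary D) ml -> rightmost (boundary D) mr ->
        [/\ param_arc r delta z0 /\ mr = curve r delta z0,
            param_arc r delta (-1) /\ ml = curve r delta (-1),
            r = 1%N -> ml = (- (2 - delta) / delta)%:C /\ mr = 1,
            (2 <= r)%N ->
              ml = (- (2 - delta) ^+ r / (2 ^+ r - (2 - delta) ^+ r))%:C /\
              mr = ((2 - delta) ^+ r /
                    ((2 - delta) ^+ r + 2 ^+ r * cos (pi / r%:R) ^+ r))%:C &
            complex.Im ml = 0 /\ complex.Im mr = 0]].
Proof.
move=> r15 d01 D z0; have r0 : (0 < r)%N by case/andP: r15.
have K1 := kapX_gt1 r0 d01.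
have bE : boundary D = root_curve r (kap delta ^+ r).
  by rewrite /D Dminfty_region// boundary_region.
have [a0 zE] := zstartE r0 d01.
have dl1 : (-1 : R[i]) - 1 + delta%:C = (delta - 2)%:C.
  by rewrite rmorphB rmorph_nat; ring.
have am1 : (-1 : R[i]) - 1 + delta%:C != 0.
  by rewrite dl1 realC_eq0 lt_eqF//; lra.
have m1E : (-1 : R[i]) - 1 = (kap delta)%:C * 1 * (-1 - 1 + delta%:C).
  rewrite dl1 mulr1 -rmorphM (_ : kap delta * (delta - 2) = - 2).
    by rewrite rmorphN rmorph_nat; ring.
  by have := kapE d01; lra.
have nm1 : normc (-1 : R[i]) = 1 by rewrite normcN normc1.
split.
- by rewrite /D Dminfty_region//; exact: region_simply_connected.
- by rewrite /D Dminfty_region//; exact: region0.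
- by rewrite bE /root_curve -curve_param_arc.
- rewrite bE; split.
    exists ((1 - kap delta ^+ r)^-1)%:C; split; first exact/leftmost_root_curve.
    by move=> m /leftmost_root_curve ->.
  exists ((1 + kap delta ^+ r * cosr R r ^+ r)^-1)%:C.
  split; first exact/rightmost_root_curve.
  by move=> m /rightmost_root_curve ->.
rewrite bE => ml mr /(leftmost_root_curve r15 K1) mlE /(rightmost_root_curve
  r15 K1) mrE.
have d2 : 0 < 2 - delta by lra.
have KE : kap delta ^+ r = 2 ^+ r / (2 - delta) ^+ r by rewrite /kap expr_div_n.
have [zu zi] := (zstart_unit r0 d01, Im_zstart_ge0 r0 d01).
split.
- split; first by rewrite param_arcP.
  rewrite mrE (curveE r a0 zE) vstartX// mulrN opprK.
  by rewrite fmorphV rmorphD rmorphM rmorph1.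
- split.
    rewrite param_arcP//=; split => //.
    by have := ler_Re_normc z0; rewrite zu ler_norml => /andP[].
  by rewrite mlE (curveE r am1 m1E) expr1n mulr1 fmorphV rmorphB rmorph1.
- move=> r1; rewrite mlE mrE r1 /cosr eqxx !expr1 mulr0 addr0 invr1; split=> //.
  congr (_%:C); rewrite /kap; field.
  by apply/and3P; split; [rewrite gt_eqF|rewrite gt_eqF|rewrite lt_eqF]; lra.
- move=> r2; rewrite mlE mrE KE /cosr gtn_eqF//.
  have Bp : 0 < (2 - delta) ^+ r by rewrite exprn_gt0.
  have AB : (2 - delta) ^+ r < 2 ^+ r by rewrite ltr_pXn2r ?nnegrE ?(ltW d2)//;
    lra.
  have C0 : 0 <= cos (pi / r%:R : R) ^+ r by rewrite exprn_ge0// cos_piV_ge0.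
  have A0 : 0 < 2 ^+ r :> R by rewrite exprn_gt0.
  move: ((2 - delta) ^+ r) (2 ^+ r) (cos _ ^+ r) Bp AB C0 A0 => B A C Bp AB C0
    A0.
  have B0 : B != 0 by rewrite gt_eqF.
  split; congr (_%:C).
    by field; rewrite B0 -opprB oppr_eq0 !subr_eq0 lt_eqF.
  by field; rewrite B0 gt_eqF// ltr_pwDl// mulr_ge0 ?(ltW A0).
- by rewrite mlE mrE.
Qed.
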